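(* Let $\xi$ be a non-negative integer-valued random variable with $\mathbb{E}\xi=1$ and $0<\mathrm{Var}(\xi)<\infty$, let $p_i=\mathbb{P}(\xi=i)$, and let $\mathcal{T}_n$ be the Galton-Watson tree with offspring distribution $\xi$ conditioned to have $n$ nodes. Assume $p_r>0$ for some $r\ge2$. Let $$\alpha_r=\log_r\left(\log\frac1{p_0}+\frac1{r-1}\log\frac1{p_r}\right).$$ Let $\omega_n\to\infty$ be an arbitrary sequence and let $h_n\to\infty$ be a sequence of positive integers. For an integer $h$ let $\mathcal{A}_{h,r}$ be the set of all possible complete $r$-ary trees of height at most $h$. (i) If $h_n\le\log_r(\log n-\omega_n)-\alpha_r$, then with high probability $\mathcal{T}_n$ contains all trees in $\mathcal{A}_{h_n,r}$ as fringe subtrees. (ii) If $h_n\ge\log_r(\log n+\omega_n)-\alpha_r$, then with high probability $\mathcal{T}_n$ does not contain all trees in $\mathcal{A}_{h_n,r}$ as fringe subtrees. Also, with $H_{n,r}:=\max\{h:\mathcal{T}_n\text{ contains all trees in }\mathcal{A}_{h,r}\text{ as fringe subtrees}\}$, $$H_{n,r}-\log_r\log n\to-\alpha_r\quad\text{in probability as }n\to\infty.$$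
   Context: A plane tree is a finite rooted, ordered, unlabeled tree. For a node $v$ of $T$, the fringe subtree $T_v$ consists of $v$ and all its descendants; $T$ contains $T'$ as a fringe subtree if $T_v$ is isomorphic (as a plane tree) to $T'$ for some $v$. The Galton-Watson tree $\mathcal{T}$ is generated from the root by giving each node independently a number of children distributed as $\xi$; $\mathcal{T}_n$ is $\mathcal{T}$ conditioned on $|\mathcal{T}|=n$. A tree $T$ is possible if $\mathbb{P}(\mathcal{T}=T)>0$. The complete $r$-ary tree of height $h$ is the plane tree in which all nodes at depth less than $h$ have exactly $r$ children and all nodes at depth $h$ are leaves. Let $h_\xi=\gcd\{i\ge1:p_i>0\}$; then $\mathbb{P}(|\mathcal{T}|=n)>0$ for all large $n\equiv1\pmod{h_\xi}$, and all limits as $n\to\infty$ are along such $n$. ''With high probability'' means with probability tending to $1$.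
   Formalization: The last claim fails as written, since H_{n,r} is an integer while log_r log n grows with vanishing increments; it is replaced by: for every ε>0, whp ⌊log_r log n − α_r − ε⌋ ≤ H_{n,r} ≤ ⌊log_r log n − α_r + ε⌋. *)

(* Defs.v *)
(* MathComp / MathComp-Analysis, over an arbitrary [R : realType]. *)
From HB Require Import structures.
From mathcomp Require Export all_boot all_order all_algebra.
From mathcomp Require Export all_classical all_reals all_analysis.

Set Implicit Arguments.
Unset Strict Implicit.
Unset Printing Implicit Defensive.

Import Order.TTheory GRing.Theory Num.Theory.
Import numFieldNormedType.Exports.

Local Open Scope classical_set_scope.
Local Open Scope ring_scope.

(* Isomorphism of finite rooted, ordered, unlabeled trees is equality here. *)
Inductive plane_tree := Node of seq plane_tree.

Definition children (t : plane_tree) : seq plane_tree := let: Node ts := t in ts.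

Fixpoint tsize (t : plane_tree) : nat :=
  let: Node ts := t in (sumn [seq tsize s | s <- ts]).+1.

(* Nodes have Ulam-Harris addresses: the root is [::], and i :: v is the node v
   of the subtree rooted at the i-th child (counted from 0) of the root; so the
   depth of v is [size v].  [fringe_at t v] is the fringe subtree t_v, and it is
   None exactly when v is not a node of t. *)
Fixpoint fringe_at (t : plane_tree) (v : seq nat) : option plane_tree :=
  if v is i :: v' then
    if onth (children t) i is Some s then fringe_at s v' else None
  else Some t.

Definition fringe_subtrees (t : plane_tree) : set plane_tree :=
  [set s | exists v, fringe_at t v = Some s].

Definition is_complete (r h : nat) (t : plane_tree) : Prop :=
  forall v s, fringe_at t v = Some s ->
    ((size v < h)%N -> size (children s) = r) /\
    (size v = h -> size (children s) = 0%N).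

(* The maximum of a set of naturals, and 0 if there is none. *)
Definition max_nat (E : set nat) : nat :=
  xget 0%N [set m | E m /\ forall k, E k -> (k <= m)%N].

Definition gcd_set (E : set nat) : nat :=
  max_nat [set d | forall i, E i -> (d %| i)%N].

Definition logr (R : realType) (r : nat) (x : R) : R := ln x / ln r%:R.

Section GaltonWatson.
Context (R : realType) (d : measure_display) (Omega : measurableType d)
  (P : probability Omega R).

Definition offspring_prob (xi : {RV P >-> nat}) (i : nat) : R :=
  fine (P (xi @^-1` [set i])).

Definition mutually_independent (I : choiceType) (X : I -> {RV P >-> nat}) : Prop :=
  forall (s : seq I) (B : I -> set nat), uniq s ->
    (forall i, measurable (B i)) ->
    P (\bigcap_(i in [set` s]) (X i @^-1` B i)) =
    (\prod_(i <- s) P (X i @^-1` B i))%E.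

Definition iid_copies (xi : {RV P >-> nat}) (I : choiceType)
    (X : I -> {RV P >-> nat}) : Prop :=
  mutually_independent X /\
  forall (i : I) (B : set nat), measurable B -> P (X i @^-1` B) = P (xi @^-1` B).

Definition offspring_span (xi : {RV P >-> nat}) : nat :=
  gcd_set [set i | (0 < i)%N /\ 0 < offspring_prob xi i].

(* n -> oo along n = 1 mod offspring_span *)
Definition adm_infty (xi : {RV P >-> nat}) : set_system nat :=
  within [set n | n = 1 %[mod offspring_span xi]] \oo.

(* xi_ u is the number of children that the node with address u has, if this
   node is generated. *)
Variable xi_ : seq nat -> {RV P >-> nat}.

(* The outcome w generates the finite tree t; no finite t qualifies when the
   generated tree is infinite. *)
Definition generates (w : Omega) (t : plane_tree) : Prop :=
  forall v s, fringe_at t v = Some s -> xi_ v w = size (children s).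

Definition gw_event (A : set plane_tree) : set Omega :=
  [set w | exists2 t, A t & generates w t].

Definition possible (t : plane_tree) : Prop := (0 < P (gw_event [set t]))%E.

(* P(T_n \in A), the probability of T \in A given |T| = n *)
Definition cgw_prob (n : nat) (A : set plane_tree) : R :=
  fine (P (gw_event (A `&` [set t | tsize t = n]))) /
  fine (P (gw_event [set t | tsize t = n])).

Definition complete_trees (r h : nat) : set plane_tree :=
  [set t | possible t /\ exists2 k, (k <= h)%N & is_complete r k t].

Definition contains_complete (r h : nat) : set plane_tree :=
  [set t | complete_trees r h `<=` fringe_subtrees t].

Definition max_complete (r : nat) (t : plane_tree) : nat :=
  max_nat [set h | contains_complete r h t].

End GaltonWatson.

Definition alpha (R : realType) (r : nat) (p : nat -> R) : R :=
  logr r (ln (1 / p 0%N) + 1 / (r%:R - 1) * ln (1 / p r)).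

(* Main.v *)
Require Import Defs.
From mathcomp Require Import fingroup perm ring lra zify.
Import Order.TTheory GRing.Theory Num.Theory.
Import numFieldNormedType.Exports.
Local Open Scope classical_set_scope.
Local Open Scope ring_scope.

(** Why the theorem is true.

    A plane tree is determined by its preorder word of outdegrees, and the
    probability that the Galton-Watson process generates t is the product of
    the p_c over the letters c of that word.  Everything about T_n is thus a
    ratio of finite sums over the words of length n with letter sum n - 1,
    weighted by products of the p_c.  By the cycle lemma each such word has
    exactly one rotation that is the word of a tree ([sum_luk]), so
    rotation-invariant events may be studied on all words instead of tree
    words.  Containing a given tree s as a fringe subtree is such an event: it
    means that the word of s occurs cyclically ([occ_fringe]), and since a tree
    word has no proper border, distinct occurrences never overlap
    ([occ_disjoint]).

    The threshold comes from the first two moments of the number N of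
    occurrences of s.  Instead of a local limit theorem, the computation
    conditions on the numbers of letters 0 and r.  Given these, the weight is
    exchangeable, and the probability that prescribed letters stand at
    prescribed places is a ratio of falling factorials ([sum_matches]).  If both
    letter frequencies are within a factor 1 + o(1/log n) of p_0 and p_r, and s
    has O(log n) nodes, these ratios are the product pi of the p_c over the word
    of s up to a factor 1 + o(1).  Hence N has mean about n pi and variance
    O(n pi) + o((n pi)^2) on typical words, so N > 0 with high probability when
    n pi tends to infinity, and N = 0 with high probability when n pi tends to 0
    ([hit_mass_upper], [miss_mass_upper]).

    Atypical words are negligible although the condition on the letter sum has
    small probability.  By a Chernoff bound an atypical word has probability
    exp(- c n^(3/4)) ([cnt_tail]), while the letter sum equals n - 1 with
    probability at least exp(- C n^(1/2)) ([word_mass_lower_bound]): Chebyshev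
    puts the sum of the first n - L letters, L of order n^(1/2), within O(L) of
    its mean, and a fixed set of letters can then complete the word in L steps.
    This is where the finite variance enters, and where n = 1 modulo the span is
    needed.

    Finally the complete tree of height h has
    ln pi = b - r^h r^alpha for a constant b ([complete_tree_weight]), and it
    contains all lower complete trees, so containing all of them up to height h
    means containing the one of height h ([contains_completeE]).  Thus the
    threshold for n pi is r^(h + alpha) = ln n. *)

Set Implicit Arguments.
Unset Strict Implicit.
Unset Printing Implicit Defensive.

(** * Plane trees and their preorder words *)

Section PreorderWords.
Local Open Scope nat_scope.

Fixpoint preorder (t : plane_tree) : seq nat :=
  let: Node ts := t in size ts :: flatten [seq preorder s | s <- ts].

Definition forest_code (ts : seq plane_tree) : seq nat :=
  flatten [seq preorder s | s <- ts].

(** The induction principle generated for [plane_tree] gives no hypothesis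
    on the subtrees, because they are nested in a list; this one carries a
    companion property of forests. *)
Definition plane_tree_forest_ind (PT : plane_tree -> Prop)
    (PF : seq plane_tree -> Prop)
    (PNode : forall ts, PF ts -> PT (Node ts)) (Pnil : PF [::])
    (Pcons : forall t ts, PT t -> PF ts -> PF (t :: ts)) : forall t, PT t :=
  fix tree_ind t := let: Node ts := t in
    PNode ts ((fix forest_ind (us : seq plane_tree) : PF us :=
      if us is u :: us' then Pcons u us' (tree_ind u) (forest_ind us')
      else Pnil) ts).

Lemma preorderE ts : preorder (Node ts) = size ts :: forest_code ts.
Proof. by []. Qed.

Lemma forest_code_cons t ts :
  forest_code (t :: ts) = preorder t ++ forest_code ts.
Proof. by []. Qed.

Lemma forest_code_cat ts us :
  forest_code (ts ++ us) = forest_code ts ++ forest_code us.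
Proof. by rewrite /forest_code map_cat flatten_cat. Qed.

Lemma size_preorder t : size (preorder t) = tsize t.
Proof.
pose PF ts := size (forest_code ts) = sumn [seq tsize s | s <- ts].
move: t; refine (@plane_tree_forest_ind _ PF _ _ _) => // [ts IH|t ts IHt IHts].
  by rewrite preorderE [LHS]/= IH.
by rewrite /PF forest_code_cons size_cat IHt IHts.
Qed.

Lemma size_preorder_gt0 t : 0 < size (preorder t).
Proof. by case: t. Qed.

(** Every node except the roots is counted once as a child. *)
Lemma sumn_forest_code ts :
  sumn (forest_code ts) + size ts = size (forest_code ts).
Proof.
have node t : (sumn (preorder t)).+1 = size (preorder t).
  pose PF us := sumn (forest_code us) + size us = size (forest_code us).
  move: t; refine (@plane_tree_forest_ind _ PF _ _ _) => // [us Pus|t us IHt IHus].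
    by rewrite preorderE /= -Pus addnC.
  by rewrite /PF forest_code_cons size_cat sumn_cat /= -IHt -IHus; lia.
elim: ts => // t ts IH.
by rewrite forest_code_cons sumn_cat size_cat -IH -node /=; lia.
Qed.

Definition push (c : nat) (stack : seq plane_tree) : seq plane_tree :=
  Node (take c stack) :: drop c stack.

(** Reading a word from right to left with a stack of trees inverts the
    preorder coding; it reconstructs the trees hanging from each suffix. *)
Definition parse (s : seq nat) : seq plane_tree := foldr push [::] s.

Lemma foldr_push_preorder t st : foldr push st (preorder t) = t :: st.
Proof.
pose PF ts := forall st, foldr push st (forest_code ts) = ts ++ st.
move: t st; refine (@plane_tree_forest_ind _ PF _ _ _) => // [ts IH st|t ts IHt
  IHts st].
  by rewrite preorderE /= IH /push take_size_cat // drop_size_cat.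
by rewrite forest_code_cons foldr_cat IHts IHt.
Qed.

Lemma parse_preorder_cat t s : parse (preorder t ++ s) = t :: parse s.
Proof. by rewrite /parse foldr_cat foldr_push_preorder. Qed.

(** Tree words form a prefix code, which is what makes occurrences of a tree
    word at a node equivalent to equality of the fringe subtree there. *)
Lemma preorder_cat_inj t t' s s' :
  preorder t ++ s = preorder t' ++ s' -> t = t'.
Proof. by move=> /(congr1 parse); rewrite !parse_preorder_cat => -[]. Qed.

(** The Lukasiewicz condition, stated on suffixes: every nonempty suffix has
    more letters than its sum, which is what the stack of [parse] needs in order
    never to run out of trees. *)
Definition luk (s : seq nat) : bool :=
  ((sumn s).+1 == size s) &&
  all (fun i => sumn (drop i s) < size s - i) (iota 0 (size s)).

Lemma lukP s : reflect ((sumn s).+1 = size s /\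
    forall i, i < size s -> sumn (drop i s) < size (drop i s)) (luk s).
Proof.
apply: (iffP andP) => [[/eqP ss /allP h]|[ss h]]; split => //; first 1 last.
- by rewrite ss.
- by apply/allP => i; rewrite mem_iota -size_drop; apply: h.
by move=> i ilt; rewrite size_drop; apply: h; rewrite mem_iota.
Qed.

Lemma forest_code_parse s :
  (forall i, i < size s -> sumn (drop i s) < size (drop i s)) ->
  forest_code (parse s) = s.
Proof.
elim: s => // c s IH h.
have {IH}es : forest_code (parse s) = s.
  by apply: IH => i ilt; apply: (h i.+1).
have := h 0 isT; rewrite drop0 /= => hc.
have /= cle : c <= size (parse s).
  by have := sumn_forest_code (parse s); rewrite es; lia.
rewrite /= -/(parse s) /push forest_code_cons preorderE size_take_min.
rewrite (minn_idPl cle) cat_cons; congr cons.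
by rewrite -forest_code_cat cat_take_drop.
Qed.

Lemma luk_preorder_parse s : luk s -> exists t, preorder t = s.
Proof.
move=> /lukP [ss /forest_code_parse es].
have := sumn_forest_code (parse s); rewrite es -ss.
case: (parse s) es => [|t [|t' ts]] es /=; try lia.
by exists t; rewrite -es /forest_code /= cats0.
Qed.

Lemma onth_split (T : Type) (s : seq T) j x :
  onth s j = Some x -> s = take j s ++ x :: drop j.+1 s.
Proof.
elim: s j => [|y s IH] [|j] //= => [[->]|/IH {1}->] //.
by rewrite drop0.
Qed.

(** A suffix of the word of t starts with the word of the fringe subtree at
    the node where it begins. *)
Lemma drop_preorder t i : i < size (preorder t) ->
  exists s ts, fringe_subtrees t s /\ drop i (preorder t) = forest_code (s :: ts).
Proof.
pose PF ts := forall i, i < size (forest_code ts) -> exists j t s us,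
  [/\ onth ts j = Some t, fringe_subtrees t s
    & drop i (forest_code ts) = forest_code (s :: us)].
move: t i; refine (@plane_tree_forest_ind _ PF _ _ _) => // [ts IH [_|i]|t ts IHt
  IHts i].
- by exists (Node ts), [::]; split; [exists [::]|rewrite drop0 /forest_code /= cats0].
- rewrite preorderE ltnS => /IH [j [t [s [us [tsj [v tv] e]]]]].
  exists s, us; split; last by [].
  by exists (j :: v); rewrite /= tsj.
rewrite forest_code_cons size_cat => ilt.
have [it|it] := ltnP i (size (preorder t)).
  have [s [us [fs e]]] := IHt _ it.
  exists 0, t, s, (us ++ ts); split=> //.
  by rewrite drop_cat it e -forest_code_cat.
have [|j [u [s [us [tsj fs e]]]]] := IHts (i - size (preorder t)).
  by rewrite ltn_subLR.
by exists j.+1, u, s, us; split=> //; rewrite drop_cat ltnNge it.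
Qed.

Lemma fringe_infix t s : fringe_subtrees t s ->
  exists x y, preorder t = x ++ preorder s ++ y.
Proof.
move=> [v]; elim: v t => [|j v IH] [ts] /=.
  by move=> [<-]; exists [::], [::]; rewrite cats0.
case tsj: (onth ts j) => [u|//] /IH [x [y e]].
rewrite -[flatten _]/(forest_code ts) (onth_split tsj) forest_code_cat.
rewrite forest_code_cons e.
by eexists (_ :: forest_code _ ++ x), (y ++ forest_code _); rewrite /= -!catA.
Qed.

Lemma luk_preorder t : luk (preorder t).
Proof.
apply/lukP; split.
  by have := sumn_forest_code [:: t]; rewrite /forest_code /= cats0 addn1.
move=> i /drop_preorder [s [us [_ ->]]].
by rewrite -(sumn_forest_code (s :: us)) /=; lia.
Qed.

(** If u ++ v and v ++ u were both tree words, then the suffixes v and u would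
    both have a sum smaller than their length, so the total would be at most the
    length minus 2. *)
Lemma luk_rot_uniq s d e : d < size s -> e < size s ->
  luk (rot d s) -> luk (rot e s) -> d = e.
Proof.
have key a b : a < b -> b < size s -> luk (rot a s) -> luk (rot b s) -> False.
  move=> ab bs la lb; pose x := rot a s.
  have sx : size x = size s by rewrite size_rot.
  have ex : rot b s = rot (b - a) x.
    by rewrite /x -rotD ?subnK //; lia.
  have /lukP [sumx hx] := la.
  have := hx (b - a); rewrite -/x size_drop sx => h1.
  move: lb; rewrite ex => /lukP [_ hy].
  have := hy (size s - (b - a)); rewrite size_rot sx {1 2}/rot.
  rewrite drop_size_cat ?size_drop ?sx // size_takel ?sx; last by lia.
  have := sumx; rewrite -/x -{1}(cat_take_drop (b - a) x) sumn_cat sx; lia.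
move=> ds es ld le; have [h|h|//] := ltngtP d e.
- by case: (key _ _ h es ld le).
- by case: (key _ _ h ds le ld).
Qed.

(** The walk with steps (letter - 1) ends at -1; the rotation starting at its
    first minimum over one period is a tree word. *)
Lemma luk_rot_exists s : (sumn s).+1 = size s ->
  exists2 d, d < size s & luk (rot d s).
Proof.
move=> ss; have s0 : 0 < size s by rewrite -ss.
(* The walk after i steps, shifted by the length of s to remain a natural
   number. *)
pose G i := sumn (take i s) + (size s - i).
pose A d := (d < size s) && all (fun j => G d <= G j) (iota 0 (size s)).
have exA : exists d, A d.
  have [d _ dmin] := @arg_minnP 'I_(size s) (Ordinal s0) xpredT G isT.
  exists d; rewrite /A ltn_ord; apply/allP => j; rewrite mem_iota => /= js.
  exact: (dmin (Ordinal js)).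
have [d /andP [ds /allP dmin] dfst] := ex_minnP exA.
have dlt j : j < d -> G d < G j.
  move=> jd; rewrite ltnNge; apply: contraL jd => Gjd; rewrite -leqNgt.
  have [js|js] := ltnP j (size s); last exact: leq_trans (ltnW ds) js.
  by apply: dfst; rewrite /A js; apply/allP => i /dmin; apply: leq_trans.
have sumd j : sumn (drop j s) = sumn s - sumn (take j s).
  by rewrite -{2}(cat_take_drop j s) sumn_cat; lia.
have sumt j : sumn (take j s) <= sumn s.
  by rewrite -{2}(cat_take_drop j s) sumn_cat; lia.
exists d => //; apply/lukP; split.
  by rewrite size_rot /rot sumn_cat addnC -sumn_cat cat_take_drop.
move=> i; rewrite size_rot /rot => i_lt.
rewrite drop_cat size_drop; case: (ltnP i (size s - d)) => id.
  rewrite drop_drop sumn_cat size_cat size_drop size_takel ?(ltnW ds) //.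
  have := dmin (i + d); rewrite mem_iota /= /G sumd.
  have := sumt (i + d); lia.
have := dlt (i - (size s - d)); set j := i - _ => /(_ ltac:(lia)).
rewrite /G size_drop size_takel ?(ltnW ds) //.
have jd : j <= d by rewrite /j; lia.
have := cat_take_drop j (take d s); rewrite take_takel // => /(congr1 sumn).
by rewrite sumn_cat; lia.
Qed.

End PreorderWords.

(** * Fringe subtrees as cyclic occurrences of words *)

Section CyclicOccurrences.
Local Open Scope nat_scope.

(** An occurrence that wraps around cannot exist: the suffix where it starts
    begins with a complete tree word, and so does the word of s, so the two trees
    agree and the occurrence already ends inside the word of t. *)
Lemma cyclic_occ_fringe t s : fringe_subtrees t s <->
  exists2 i, i < tsize t & forall j, j < tsize s ->
    nth 0 (preorder t) ((i + j) %% tsize t) = nth 0 (preorder s) j.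
Proof.
rewrite -!size_preorder; split.
  move=> /fringe_infix [x [y e]]; exists (size x).
    by rewrite e !size_cat; have := size_preorder_gt0 s; lia.
  move=> j js; rewrite modn_small; last by rewrite e !size_cat; lia.
  by rewrite e nth_cat ltnNge leq_addr /= addKn nth_cat js.
move=> [i it h].
have [v [us [fv e]]] := drop_preorder it.
rewrite forest_code_cons in e.
have sv : size (preorder v) <= size (preorder t) - i.
  by rewrite -size_drop e size_cat leq_addr.
pose l := minn (size (preorder s)) (size (preorder t) - i).
have el : take l (drop i (preorder t)) = take l (preorder s).
  apply: (@eq_from_nth _ 0) => [|j].
    by rewrite !size_take_min size_drop /l; lia.
  rewrite size_take_min size_drop => jl.
  rewrite !nth_take ?nth_drop; try by rewrite /l; lia.
  by rewrite -h ?modn_small //; rewrite /l in jl *; lia.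
have [lv|vl] := leqP (size (preorder v)) l.
  suff <- : v = s by [].
  apply: (@preorder_cat_inj _ _ (take (l - size (preorder v)) (forest_code us) ++
    drop l (preorder s)) [::]).
  rewrite catA cats0 -[RHS](cat_take_drop l) -el e; congr cat.
  by rewrite take_cat ltnNge lv.
have ls : l = size (preorder s) by rewrite /l in vl *; lia.
move: el; rewrite ls take_size e takel_cat; last by lia.
move=> es; suff vs : v = s by move: vl; rewrite ls vs ltnn.
apply: (@preorder_cat_inj _ _ [::] (drop (size (preorder s)) (preorder v))).
by rewrite cats0 -{1}es cat_take_drop.
Qed.

(** A suffix of a tree word starts with a shorter tree word, which cannot be
    a prefix of the whole word because tree words form a prefix code. *)
Lemma preorder_unbordered s d : 0 < d < tsize s ->
  ~ (forall j, d + j < tsize s ->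
      nth 0 (preorder s) (d + j) = nth 0 (preorder s) j).
Proof.
rewrite -size_preorder => /andP [d0 ds] h.
have [v [us [_]]] := drop_preorder ds; rewrite forest_code_cons => e.
have sv : size (preorder v) < size (preorder s).
  by have := congr1 size e; rewrite size_cat size_drop; lia.
have eb : take (size (preorder s) - d) (preorder s) = drop d (preorder s).
  apply: (@eq_from_nth _ 0) => [|j].
    by rewrite size_take_min size_drop; lia.
  by rewrite size_take_min => jl; rewrite nth_take ?nth_drop ?h //; lia.
suff vs : v = s by rewrite vs ltnn in sv.
apply: (@preorder_cat_inj _ _ (forest_code us ++ drop (size (preorder s) - d)
  (preorder s)) [::]).
by rewrite catA cats0 -[RHS](cat_take_drop (size (preorder s) - d)) eb e.
Qed.

Section Words.
Variable m : nat.
Local Notation n := m.+1.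
Local Notation word := {ffun 'I_n -> 'I_n}.

Definition letters (w : word) : seq nat := [seq val (w i) | i <- enum 'I_n].

Definition shift (d : 'I_n) (w : word) : word := [ffun i => w (d + i)%R].

Definition occ (u : seq nat) (w : word) (i : 'I_n) : bool :=
  all (fun j => w (i + inZp j)%R == nth 0 u j :> nat) (iota 0 (size u)).

Lemma size_letters w : size (letters w) = n.
Proof. by rewrite size_map size_enum_ord. Qed.

Lemma nth_letters w i : nth 0 (letters w) i = if i < n then val (w (inZp i)) else 0.
Proof.
case: ltnP => i_n; last by rewrite nth_default // size_letters.
rewrite (nth_map ord0) ?size_enum_ord //; congr (val (w _)); apply/val_inj.
by rewrite /= nth_enum_ord // modn_small.
Qed.

Lemma letters_inj : injective letters.
Proof.
move=> w w' e; apply/ffunP => i; apply/val_inj.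
by have := congr1 (nth 0 ^~ i) e; rewrite !nth_letters ltn_ord valZpK.
Qed.

Lemma sumn_letters w : sumn (letters w) = \sum_i w i.
Proof. by rewrite sumnE big_map big_enum. Qed.

Lemma letters_surj s : size s = n -> all (fun c => c < n) s ->
  exists w, letters w = s.
Proof.
move=> ss /allP hs; exists [ffun i : 'I_n => inord (nth 0 s i)].
apply: (@eq_from_nth _ 0) => [|i]; rewrite size_letters // => i_n.
rewrite nth_letters i_n ffunE /= modn_small // inordK //.
by apply: hs; rewrite mem_nth // ss.
Qed.

Lemma letters_shift d w : letters (shift d w) = rot d (letters w).
Proof.
apply: (@eq_from_nth _ 0) => [|i]; rewrite size_letters ?size_rot ?size_letters //.
move=> i_n; have dn := ltn_ord d.
rewrite nth_letters i_n ffunE /rot nth_cat size_drop size_letters.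
case: ltnP => id.
  rewrite nth_drop nth_letters ltn_subRL in id *; rewrite id.
  by congr (val (w _)); apply/val_inj; rewrite /= modnDmr.
rewrite nth_take; last by lia.
rewrite nth_letters ifT; last by lia.
congr (val (w _)); apply/val_inj; rewrite /= modnDmr.
by rewrite -(modnDr (i - (n - d))) ; congr (_ %% _); lia.
Qed.

Lemma occ_shift u w d i : occ u (shift d w) i = occ u w (d + i)%R.
Proof. by apply: eq_all => j; rewrite ffunE addrA. Qed.

Lemma occ_fringe w t s : letters w = preorder t ->
  fringe_subtrees t s <-> exists i, occ (preorder s) w i.
Proof.
move=> e; have tn : tsize t = n by rewrite -size_preorder -e size_letters.
rewrite cyclic_occ_fringe tn -e; split=> [[i i_n h]|[i h]].
  exists (Ordinal i_n); apply/allP => j; rewrite mem_iota size_preorder => js.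
  rewrite -h // nth_letters ltn_mod /=; apply/eqP; congr (val (w _)).
  by apply/val_inj; rewrite /= modn_mod modnDmr.
exists (val i) => [|j js]; first exact: ltn_ord.
move/allP: h => /(_ j).
rewrite mem_iota size_preorder nth_letters ltn_mod => /(_ js)/eqP <-.
by congr (val (w _)); apply/val_inj; rewrite /= modn_mod modnDmr.
Qed.

Lemma occ_disjoint w s i i' j j' : i != i' -> j < tsize s -> j' < tsize s ->
  occ (preorder s) w i -> occ (preorder s) w i' ->
  (i + inZp j != i' + inZp j' :> 'I_n)%R.
Proof.
wlog jj' : i i' j j' / j' <= j.
  move=> H ii' js j's oi oi'; have [le|/ltnW le] := leqP j' j; first exact: H.
  by rewrite eq_sym; apply: H => //; rewrite eq_sym.
have inZpD a b : inZp (a + b) = (inZp a + inZp b)%R :> 'I_n.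
  by apply/val_inj; rewrite /= modnDm.
move=> ii' js j's /allP oi /allP oi'; apply/eqP => e.
have [ejj|jNj] := eqVneq j j'.
  by move: ii' e; rewrite ejj => /eqP ii' /addIr.
have d0 : 0 < j - j' < tsize s by lia.
have i'E : i' = (i + inZp (j - j'))%R.
  by apply: (@addIr _ (inZp j')); rewrite -e -addrA -inZpD subnK.
apply: (preorder_unbordered d0) => k kd.
have := oi (j - j' + k); rewrite mem_iota size_preorder => /(_ kd)/eqP <-.
have /eqP <- := oi' k ltac:(rewrite mem_iota size_preorder; lia).
by rewrite i'E inZpD addrA.
Qed.

End Words.

End CyclicOccurrences.

(** * Moments of occurrence counts under an exchangeable weight *)

Section Exchangeable.
Context (R : realFieldType) (m : nat).
Local Notation n := m.+1.
Local Notation word := {ffun 'I_n -> 'I_n}.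

Definition cnt (c : nat) (w : word) : nat := (\sum_i (w i == c :> nat))%N.

Definition exchangeable (F : word -> R) : Prop :=
  forall (s : {perm 'I_n}) (w : word), F [ffun i => w (s i)] = F w.

Definition matches (Q : seq ('I_n * nat)) (w : word) : bool :=
  all (fun q => w q.1 == q.2 :> nat) Q.

(** The probability of drawing the letters cs without replacement from the
    letters of w: each factor is the number of remaining copies of a letter over
    the number of remaining positions. *)
Fixpoint draw_ratio (w : word) (cs : seq nat) : R :=
  if cs is c :: cs' then
    ((cnt c w)%:R - (count_mem c cs')%:R) / (n%:R - (size cs')%:R)
      * draw_ratio w cs'
  else 1.

Lemma sum_perm (s : {perm 'I_n}) (G : word -> R) :
  \sum_(w : word) G [ffun i => w (s i)] = \sum_w G w.
Proof.
rewrite [RHS](reindex (fun w : word => [ffun i => w (s i)])) //.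
exists (fun w : word => [ffun i => w ((s^-1)%g i)] : word) => w _;
  by apply/ffunP => i; rewrite !ffunE ?permK ?permKV.
Qed.

Lemma cnt_perm c (s : {perm 'I_n}) (w : word) : cnt c [ffun i => w (s i)] = cnt c w.
Proof.
rewrite /cnt [RHS](reindex_inj (@perm_inj _ s)).
by apply: eq_bigr => i _; rewrite ffunE.
Qed.

(** Exchangeability makes the weight of prescribing the letter c at a new
    position independent of that position; summing over all free positions counts
    the copies of c that the prescribed letters have not used yet. *)
Lemma sum_matches (F : word -> R) (Q : seq ('I_n * nat)) :
  exchangeable F -> uniq (unzip1 Q) ->
  \sum_w F w * (matches Q w)%:R = \sum_w F w * draw_ratio w (unzip2 Q).
Proof.
elim: Q F => [|[i c] Q IH] F exF /=; first by move=> _; apply: eq_bigr.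
move=> /andP [iQ uQ].
pose S i := \sum_w F w * ((w i == c :> nat) && matches Q w)%:R.
have Seq i' : i' \notin unzip1 Q -> S i' = S i.
  move=> i'Q; rewrite /S -(sum_perm (tperm i i')); apply: eq_bigr => w _.
  rewrite exF ffunE tpermR; congr (_ * (_ && _)%:R).
  apply: eq_in_all => q qQ /=; rewrite ffunE tpermD //.
    by apply: contraNneq iQ => ->; apply: map_f.
  by apply: contraNneq i'Q => ->; apply: map_f.
have cQ : (#|[pred i' | i' \notin unzip1 Q]| + size Q = n)%N.
  have := cardC (mem (unzip1 Q)).
  rewrite card_ord (card_uniqP uQ) size_map => h; rewrite -[RHS]h addnC.
  by congr addn; apply: eq_card.
have nQE : n%:R - (size Q)%:R = #|[pred i' | i' \notin unzip1 Q]|%:R :> R.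
  by apply/eqP; rewrite subr_eq -natrD; apply/eqP; congr (_%:R); rewrite cQ.
have nQ0 : n%:R - (size Q)%:R != 0 :> R.
  rewrite nQE pnatr_eq0 -lt0n; apply/card_gt0P.
  by exists i; rewrite inE.
have /= sumS : \sum_(i' | i' \notin unzip1 Q) S i' = S i * (n%:R - (size Q)%:R).
  rewrite (eq_bigr (fun=> S i)) // sumr_const nQE.
  by rewrite mulr_natr.
have cnt_split w : matches Q w ->
  (\sum_(i' | i' \notin unzip1 Q) (w i' == c :> nat) + count_mem c (unzip2 Q)
    = cnt c w)%N.
  move=> mQ; rewrite /cnt [RHS](bigID [in unzip1 Q]) /= addnC; congr addn.
  rewrite -(big_uniq _ uQ) /= big_map -sum1_count big_mkcond /= big_map.
  rewrite big_seq [RHS]big_seq; apply: eq_bigr => q qQ.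
  by have /allP /(_ _ qQ) /eqP -> := mQ; case: eqP.
transitivity (S i); first by apply: eq_bigr.
have -> : S i = (n%:R - (size Q)%:R)^-1 * \sum_(i' | i' \notin unzip1 Q) S i'.
  by rewrite sumS mulrC mulfK.
rewrite exchange_big /= mulr_sumr.
pose F' w := F w * (((cnt c w)%:R - (count_mem c (unzip2 Q))%:R) / (n%:R - (size
  Q)%:R)).
have exF' : exchangeable F' by move=> s w; rewrite /F' exF cnt_perm.
transitivity (\sum_w F' w * (matches Q w)%:R).
  apply: eq_bigr => w _; rewrite -mulr_sumr /F'.
  case: (boolP (matches Q w)) => [mQ|_]; last first.
    by rewrite big1 ?mulr0 // => j _; rewrite andbF.
  rewrite -(cnt_split w mQ) natrD addrK natr_sum mulr1.
  rewrite (eq_bigr (fun j => (w j == c :> nat)%:R)) => [|j _]; last by rewrite andbT.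
  by rewrite mulrCA [X in _ * X]mulrC.
rewrite (IH F' exF' uQ); apply: eq_bigr => w _.
by rewrite /F' /unzip2 size_map !mulrA.
Qed.

Lemma draw_ratio_bounds (p : nat -> R) lo hi (w : word) (cs : seq nat) :
  0 <= lo -> (forall c, 0 <= p c) ->
  (forall c a b, c \in cs -> (a <= b)%N -> (b < size cs)%N ->
    p c * lo <= ((cnt c w)%:R - a%:R) / (n%:R - b%:R) <= p c * hi) ->
  (\prod_(c <- cs) p c) * lo ^+ size cs <= draw_ratio w cs
    <= (\prod_(c <- cs) p c) * hi ^+ size cs.
Proof.
move=> lo0 p0; elim: cs => [|c cs IH] h /=; first by rewrite big_nil mulr1 lexx.
have /IH /andP [l1 u1] : forall c a b, c \in cs -> (a <= b)%N -> (b < size cs)%N ->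
    p c * lo <= ((cnt c w)%:R - a%:R) / (n%:R - b%:R) <= p c * hi.
  by move=> c' a b ccs ab bcs; apply: h => //; rewrite ?inE ?ccs ?orbT // ltnW.
have /andP [l2 u2] := h c (count_mem c cs) (size cs) (mem_head _ _)
  (count_size _ _) (ltnSn _).
rewrite big_cons !exprS mulrACA [X in _ <= _ <= X]mulrACA.
have pos1 : 0 <= \prod_(c0 <- cs) p c0 * lo ^+ size cs.
  by rewrite mulr_ge0 ?exprn_ge0 ?prodr_ge0.
have pos2 : 0 <= p c * lo by rewrite mulr_ge0.
apply/andP; split; apply: ler_pM => //.
  exact: le_trans pos2 l2.
exact: le_trans pos1 l1.
Qed.

Definition occ_count (u : seq nat) (w : word) : nat := (\sum_i occ u w i)%N.

Definition occ_cells (u : seq nat) (i : 'I_n) : seq ('I_n * nat) :=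
  [seq (i + inZp j, nth 0%N u j) | j <- iota 0 (size u)].

Lemma occ_matches u w i : occ u w i = matches (occ_cells u i) w.
Proof. by rewrite /matches all_map. Qed.

Lemma unzip2_occ_cells u i : unzip2 (occ_cells u i) = u.
Proof.
rewrite /unzip2 -map_comp.
apply: (@eq_from_nth _ 0%N) => [|j]; rewrite size_map size_iota // => ju.
by rewrite (nth_map 0%N) ?size_iota //= nth_iota.
Qed.

Lemma uniq_occ_cells u i : (size u <= n)%N -> uniq (unzip1 (occ_cells u i)).
Proof.
move=> un; rewrite /unzip1 -map_comp map_inj_in_uniq ?iota_uniq // => j j'.
rewrite !mem_iota /= => ju ju' /addrI/(congr1 val) /=.
by rewrite !modn_small //; lia.
Qed.

Section Moments.
Variables (F : word -> R) (p : nat -> R) (lo hi : R) (s : plane_tree).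
Hypothesis exF : exchangeable F.
Hypothesis F0 : forall w, 0 <= F w.
Hypothesis p0 : forall c, 0 <= p c.
Hypothesis lo0 : 0 <= lo.
Hypothesis sn : (tsize s <= n)%N.
Hypothesis Fgood : forall w, F w != 0 -> forall c a b, c \in preorder s ->
  (a <= b)%N -> (b < 2 * tsize s)%N ->
  p c * lo <= ((cnt c w)%:R - a%:R) / (n%:R - b%:R) <= p c * hi.

Let u := preorder s.
Let k := tsize s.
Let pi := \prod_(c <- u) p c.
Let mass := \sum_w F w.

Lemma sum_matches_bounds Q (cs := unzip2 Q) :
  uniq (unzip1 Q) -> {subset cs <= u} -> (size Q <= 2 * k)%N ->
  (\prod_(c <- cs) p c) * lo ^+ size Q * mass <= \sum_w F w * (matches Q w)%:R
    <= (\prod_(c <- cs) p c) * hi ^+ size Q * mass.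
Proof.
move=> uQ csu Qk; rewrite (sum_matches exF uQ) /mass !mulr_sumr.
have bw w : (\prod_(c <- cs) p c) * lo ^+ size Q * F w <= F w * draw_ratio w cs
    <= (\prod_(c <- cs) p c) * hi ^+ size Q * F w.
  have [->|Fw] := eqVneq (F w) 0; first by rewrite !mulr0 mul0r lexx.
  have /andP [l h] := @draw_ratio_bounds p lo hi w cs lo0 p0
    (fun c a b ccs ab bcs => Fgood Fw (csu _ ccs) ab
       (leq_trans bcs (leq_trans (eq_leq (size_map _ _)) Qk))).
  rewrite size_map in l h.
  by rewrite ![_ * F w]mulrC !ler_wpM2l.
by apply/andP; split; apply: ler_sum => w _; have /andP [] := bw w.
Qed.

Lemma occ_mean_bounds : 
  n%:R * pi * lo ^+ k * mass <= \sum_w F w * (occ_count u w)%:R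
    <= n%:R * pi * hi ^+ k * mass.
Proof.
have -> : \sum_w F w * (occ_count u w)%:R
  = \sum_i \sum_w F w * (matches (occ_cells u i) w)%:R.
  rewrite exchange_big; apply: eq_bigr => w _.
  rewrite /occ_count natr_sum mulr_sumr.
  by apply: eq_bigr => i _; rewrite occ_matches.
have cst (x : R) : n%:R * x = \sum_(i < n) x by rewrite sumr_const card_ord mulr_natl.
have szk i : size (occ_cells u i) = k by rewrite !size_map size_iota size_preorder.
have bi i := @sum_matches_bounds (occ_cells u i) 
  (uniq_occ_cells i (leq_trans (eq_leq (size_preorder s)) sn)).
rewrite -!mulrA !cst; apply/andP; split; apply: ler_sum => i _;
  have := bi i; rewrite unzip2_occ_cells szk -!mulrA mul2n -addnn leq_addr => /(_
    _ _)/andP[] //.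
Qed.

(** A pair of distinct occurrences either overlaps, which is impossible, or
    prescribes two disjoint copies of the word; only the diagonal contributes the
    first moment. *)
Lemma occ_second_moment_bound : 
  \sum_w F w * (occ_count u w)%:R ^+ 2
    <= \sum_w F w * (occ_count u w)%:R + (n%:R * pi * hi ^+ k) ^+ 2 * mass.
Proof.
have -> : \sum_w F w * (occ_count u w)%:R ^+ 2 = 
    \sum_i \sum_j \sum_w F w * (occ u w i && occ u w j)%:R.
  transitivity (\sum_i \sum_w \sum_j F w * (occ u w i && occ u w j)%:R); last first.
    by apply: eq_bigr => i _; rewrite exchange_big.
  rewrite exchange_big; apply: eq_bigr => w _.
  rewrite /occ_count natr_sum expr2 mulr_suml mulr_sumr; apply: eq_bigr => i _.
  rewrite !mulr_sumr; apply: eq_bigr => j _.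
  by rewrite -natrM mulnb.
have -> : \sum_w F w * (occ_count u w)%:R
  = \sum_i \sum_w F w * (occ u w i)%:R.
  rewrite exchange_big; apply: eq_bigr => w _.
  by rewrite /occ_count natr_sum mulr_sumr.
have pi0 : 0 <= pi by rewrite prodr_ge0.
have mass0 : 0 <= mass by rewrite sumr_ge0.
have even_pow (x : R) : x ^+ (2 * k) = (x ^+ k) ^+ 2 by rewrite mulnC exprM.
have X0 : 0 <= pi ^+ 2 * hi ^+ (2 * k) * mass.
  by rewrite !mulr_ge0 ?sqr_ge0 // even_pow sqr_ge0.
have -> : (n%:R * pi * hi ^+ k) ^+ 2 * mass
  = \sum_(i < n) \sum_(j < n) (pi ^+ 2 * hi ^+ (2 * k) * mass).
  under eq_bigr do rewrite sumr_const.
  rewrite sumr_const card_ord -mulrnA -[RHS]mulr_natr natrM even_pow.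
  ring.
rewrite -big_split /=; apply: ler_sum => i _.
rewrite (bigD1 i) //= [X in _ <= _ + X](bigD1 i) //=.
under eq_bigr do rewrite andbb.
rewrite lerD // -[X in X <= _]add0r lerD //; apply: ler_sum => j ji.
have [/hasP [c /mapP [q qi ->] /mapP [q' qj e]]|dij] :=
  boolP (has [in unzip1 (occ_cells u j)] (unzip1 (occ_cells u i))).
  rewrite big1 // => w _; case: andP => [[oi oj]|_]; last by rewrite mulr0.
  move: qi qj => /mapP [a]; rewrite mem_iota size_preorder => au qE.
  move=> /mapP [b]; rewrite mem_iota size_preorder => bu q'E.
  have := @occ_disjoint m w s i j a b _ au bu oi oj; rewrite eq_sym => /(_ ji).
  by move: e; rewrite qE q'E /= => -> /eqP.
have szk i' : size (occ_cells u i') = k by rewrite !size_map size_iota size_preorder.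
have uQ : uniq (unzip1 (occ_cells u i ++ occ_cells u j)).
  rewrite /unzip1 map_cat cat_uniq !uniq_occ_cells ?size_preorder // has_sym.
  by rewrite (negbTE dij).
have zQ : unzip2 (occ_cells u i ++ occ_cells u j) = u ++ u.
  by rewrite /unzip2 map_cat -!/(unzip2 _) !unzip2_occ_cells.
have := @sum_matches_bounds (occ_cells u i ++ occ_cells u j) uQ.
rewrite zQ size_cat !szk addnn mul2n leqnn => /(_ _ isT).
have sub : {subset u ++ u <= u} by move=> c; rewrite mem_cat orbb.
move=> /(_ sub) /andP [_]; rewrite big_cat /= -expr2.
apply: le_trans; rewrite le_eqVlt; apply/orP; left; apply/eqP.
by apply: eq_bigr => w _; rewrite !occ_matches /matches all_cat.
Qed.

End Moments.
End Exchangeable.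

(** * The cycle lemma and Chernoff bounds in terms of word sums *)

(** Squaring the bound 1 - x/2 <= exp(- x/2) reduces this to a polynomial
    inequality; the range of x is what that inequality allows. *)
Lemma expR_le_quadratic (R : realType) (x : R) : `|x| <= 1 / 3 ->
  expR x <= 1 + x + x ^+ 2.
Proof.
rewrite ler_norml => /andP [x1 x2].
have h : 1 - x / 2 <= expR (- (x / 2)) by rewrite (le_trans _ (expR_ge1Dx _)).
have h2 : (1 - x / 2) ^+ 2 * expR x <= 1.
  have -> : expR x = (expR (x / 2)) ^+ 2 by rewrite -expRM_natl; congr expR; lra.
  rewrite -exprMn expr_le1 // ?mulr_ge0 ?expR_ge0 //; try lra.
  apply: le_trans (ler_wpM2r (expR_ge0 _) h) _.
  by rewrite mulrC expRxMexpNx_1.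
have h3 : 1 <= (1 - x / 2) ^+ 2 * (1 + x + x ^+ 2) by nra.
rewrite -(@ler_pM2l _ ((1 - x / 2) ^+ 2)); last by rewrite exprn_gt0; lra.
exact: le_trans h2 h3.
Qed.

Lemma sum_pick (R : pzRingType) (f : nat -> R) M c : (c < M)%N ->
  \sum_(i < M) f i * (i == c :> nat)%:R = f c.
Proof.
move=> cM; rewrite (bigD1 (Ordinal cM)) //= eqxx mulr1 big1 ?addr0 // => j jc.
by rewrite (negbTE (_ : j != c :> nat)) ?mulr0.
Qed.

Section WordSums.
Context (R : realType) (m : nat).
Local Notation n := m.+1.
Local Notation word := {ffun 'I_n -> 'I_n}.

Lemma shiftB d : cancel (@shift m d) (shift (- d)).
Proof. by move=> w; apply/ffunP => i; rewrite !ffunE addNKr. Qed.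

Lemma sum_shift (d : 'I_n) (G : word -> R) : \sum_w G (shift d w) = \sum_w G w.
Proof.
rewrite [RHS](reindex (shift d)) //; exists (shift (- d)) => w _.
  exact: shiftB.
by rewrite -{1}[d]opprK shiftB.
Qed.

(** Each word in the sum has exactly one rotation that is a tree word, and
    rotation permutes the words. *)
Lemma sum_luk (G : word -> R) :
  (forall d (w : word), G (shift d w) = G w) ->
  (forall w : word, (\sum_i w i)%N != m -> G w = 0) ->
  \sum_w G w = n%:R * \sum_(w : word | luk (letters w)) G w.
Proof.
move=> Gs Gm.
transitivity (\sum_(w : word) \sum_(d < n) (luk (letters (shift d w)))%:R * G w).
  apply: eq_bigr => w _; have [wm|/Gm ->] := eqVneq (\sum_i w i)%N m; last first.
    by rewrite big1 // => d _; rewrite mulr0.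
  have [|d dn ld] := @luk_rot_exists (letters w).
    by rewrite sumn_letters wm size_letters.
  rewrite size_letters in dn.
  rewrite (bigD1 (Ordinal dn)) //= letters_shift ld mul1r big1 ?addr0 // => e ne.
  rewrite letters_shift; case: (boolP (luk _)) => [le|]; last by rewrite mul0r.
  move: ne; have := luk_rot_uniq _ _ ld le; rewrite size_letters => /(_ dn (ltn_ord e)).
  by move=> de /eqP []; apply/val_inj.
rewrite exchange_big /= (eq_bigr (fun=> \sum_(w : word | luk (letters w)) G w)).
  by rewrite sumr_const card_ord mulr_natl.
move=> d _; rewrite [RHS]big_mkcond /= -[RHS](sum_shift d).
by apply: eq_bigr => w _; rewrite Gs; case: ifP => _; rewrite ?mul1r ?mul0r.
Qed.

Variable p : nat -> R.
Hypothesis p0 : forall c, 0 <= p c.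
Hypothesis p1 : \sum_(c < n) p c <= 1.

Definition weight (w : word) : R := \prod_i p (w i).

Lemma weight_ge0 w : 0 <= weight w. Proof. exact: prodr_ge0. Qed.

Lemma sum_prod_letters (f : nat -> R) :
  \sum_(w : word) \prod_i f (w i) = (\sum_(c < n) f c) ^+ n.
Proof.
by rewrite -(bigA_distr_bigA (fun (_ : 'I_n) (c : 'I_n) => f c)) prodr_const card_ord.
Qed.

(** The exponential moment method, with parameter delta / 2 and the sum over
    words factored letter by letter. *)
Lemma cnt_one_sided_tail (c : nat) (sg delta : R) : (c < n)%N -> `|sg| = 1 ->
  0 <= delta <= 2 / 3 ->
  \sum_(w : word | n%:R * delta <= sg * ((cnt c w)%:R - n%:R * p c)) weight w
    <= expR (- (n%:R * delta ^+ 2 / 4)).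
Proof.
move=> cn sg1 /andP [d0 d1].
pose l := delta / 2.
pose g (j : nat) := l * (sg * ((j == c)%:R - p c)).
have pc1 : p c <= 1.
  apply: le_trans p1; rewrite (bigD1 (Ordinal cn)) //= lerDl; exact: sumr_ge0.
have gsmall j : `|g j| <= l.
  rewrite /g normrM (@ger0_norm _ l) /l; last lra.
  rewrite ler_piMr ?normrM ?sg1 ?mul1r //; first lra.
  by have := p0 c; rewrite ler_norml; case: eqP => _ /=; lra.
have mgf : \sum_(j < n) p j * expR (g j) <= expR (l ^+ 2).
  apply: le_trans (expR_ge1Dx _).
  have step j : p j * expR (g j) <= p j * (1 + g j + l ^+ 2).
    apply: ler_wpM2l => //; have gj := gsmall j.
    apply: le_trans (expR_le_quadratic _) _.
      by apply: le_trans gj _; rewrite /l; lra.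
    by rewrite lerD2l -real_normK ?num_real // lerXn2r // nnegrE /l; lra.
  apply: le_trans (ler_sum _ (fun (j : 'I_n) _ => step j)) _.
  have A1 := p1; set A := \sum_(c0 < n) p c0 in A1 *.
  have -> : \sum_(j < n) p j * (1 + g j + l ^+ 2)
    = A + l * sg * p c * (1 - A) + l ^+ 2 * A.
    transitivity (\sum_(j < n) (p j * (1 - l * sg * p c + l ^+ 2) + l * sg * (p j
      * (j == c :> nat)%:R))).
      by apply: eq_bigr => j _; rewrite /g; ring.
    rewrite big_split /= -mulr_suml -mulr_sumr.
    by rewrite sum_pick // -/A; ring.
  have A0 : 0 <= A by exact: sumr_ge0.
  have sl : l * sg * p c <= 1.
    have : `|l * sg * p c| <= 1 by rewrite !normrM sg1 mulr1 !ger0_norm //= /l;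
      have := p0 c; nra.
    by rewrite ler_norml => /andP [].
  have : l ^+ 2 * A <= l ^+ 2 by rewrite ler_piMr ?sqr_ge0.
  nra.
have bound w : (n%:R * delta <= sg * ((cnt c w)%:R - n%:R * p c)) ->
  weight w <= expR (- (n%:R * delta * l)) * \prod_i (p (w i) * expR (g (w i))).
  move=> hw; rewrite big_split /= -/(weight w) mulrCA ler_peMr ?weight_ge0 //.
  rewrite -expR_sum -expRD (le_trans _ (expR_ge1Dx _)) // lerDl.
  have -> : \sum_i g (w i) = l * (sg * ((cnt c w)%:R - n%:R * p c)).
    rewrite -!mulr_sumr sumrB sumr_const card_ord mulr_natl /cnt natr_sum.
    by [].
  rewrite addrC subr_ge0 [X in X <= _]mulrC ler_wpM2l // /l; lra.
apply: (@le_trans _ _ (\sum_(w : word) expR (- (n%:R * delta * l)) * \prod_i (p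
  (w i) * expR (g (w i))))).
  rewrite big_mkcond /=; apply: ler_sum => w _; case: ifP => [/bound //|_].
  by rewrite mulr_ge0 ?expR_ge0 ?prodr_ge0 // => i _; rewrite mulr_ge0 ?expR_ge0.
rewrite -mulr_sumr (sum_prod_letters (fun j => p j * expR (g j))).
apply: (@le_trans _ _ (expR (- (n%:R * delta * l)) * expR (l ^+ 2) ^+ n)).
  rewrite ler_wpM2l ?expR_ge0 // lerXn2r // nnegrE ?expR_ge0 //.
  by apply: sumr_ge0 => j _; rewrite mulr_ge0 ?expR_ge0.
by rewrite -expRM_natl -expRD ler_expR /l; lra.
Qed.

Lemma cnt_tail (c : nat) (delta : R) : (c < n)%N -> 0 <= delta <= 2 / 3 ->
  \sum_(w : word | ~~ (`|(cnt c w)%:R - n%:R * p c| <= n%:R * delta)) weight w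
    <= 2 * expR (- (n%:R * delta ^+ 2 / 4)).
Proof.
move=> cn d01; rewrite mulr2n mulrDl mul1r.
have h1 := @cnt_one_sided_tail c 1 delta cn (normr1 _) d01.
have h2 := @cnt_one_sided_tail c (-1) delta cn (normrN1 _) d01.
apply: le_trans (lerD h1 h2).
rewrite big_mkcond [X in _ <= X + _]big_mkcond [X in _ <= _ + X]big_mkcond /=.
rewrite -big_split /=; apply: ler_sum => w _.
have w0 := weight_ge0 w.
case: ifP => hw; last by rewrite addr_ge0 //; case: ifP.
have : (n%:R * delta <= 1 * ((cnt c w)%:R - n%:R * p c)) || 
  (n%:R * delta <= -1 * ((cnt c w)%:R - n%:R * p c)).
  move: hw; rewrite -ltNge lter_normr => /orP [] h; apply/orP; [left|right]; lra.
by case/orP => ->; [rewrite lerDl|rewrite lerDr]; case: ifP.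
Qed.

End WordSums.

(** * The mass of the words with letter sum n - 1 *)

(** A probability distribution on the natural numbers with mean 1 and finite
    second factorial moment, in terms of its partial sums, so that only finite
    sums over words occur. *)
Record critical_law (R : realType) (p : nat -> R) (v : R) : Prop := {
  law_ge0 : forall i, 0 <= p i;
  law_mass_le1 : forall M, \sum_(i < M) p i <= 1;
  law_mass_lim : forall e, 0 < e -> exists M0, forall M, (M0 <= M)%N ->
    1 - e <= \sum_(i < M) p i;
  law_mean_le1 : forall M, \sum_(i < M) p i * i%:R <= 1;
  law_mean_lim : forall e, 0 < e -> exists M0, forall M, (M0 <= M)%N ->
    1 - e <= \sum_(i < M) p i * i%:R;
  law_factorial2_le : forall M, \sum_(i < M) p i * (i * i.-1)%:R <= v }.

Lemma bernoulli_ineq (R : realDomainType) (e : R) k : 0 <= e <= 1 ->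
  1 - k%:R * e <= (1 - e) ^+ k.
Proof.
move=> /andP [e0 e1]; elim: k => [|k IH]; first by rewrite mul0r subr0 expr0.
rewrite exprS; apply: (@le_trans _ _ ((1 - e) * (1 - k%:R * e))); last first.
  by rewrite ler_wpM2l // subr_ge0.
rewrite -natr1 -subr_ge0.
have -> : (1 - e) * (1 - k%:R * e) - (1 - (k%:R + 1) * e) = k%:R * (e * e) by ring.
by rewrite !mulr_ge0.
Qed.

Section ValuesAtOne.
Variable R : comNzRingType.
Implicit Types f : nat -> R.

Lemma poly_at1 N f : (\poly_(i < N) f i).[1] = \sum_(i < N) f i.
Proof.
by rewrite horner_poly; apply: eq_bigr => i _; rewrite expr1n mulr1.
Qed.

Lemma deriv_at1 N f : (\poly_(i < N) f i)^`().[1] = \sum_(i < N) f i * i%:R.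
Proof.
rewrite poly_def raddf_sum /= horner_sum; apply: eq_bigr => i _.
by rewrite derivZ derivXn hornerZ hornerMn hornerXn expr1n.
Qed.

Lemma deriv2_at1 N f :
  (\poly_(i < N) f i)^`()^`().[1] = \sum_(i < N) f i * (i * i.-1)%:R.
Proof.
rewrite poly_def !raddf_sum /= horner_sum; apply: eq_bigr => i _.
by rewrite !derivZ derivXn derivMn derivXn hornerZ !hornerMn hornerXn expr1n
  -mulrnA mulnC.
Qed.

End ValuesAtOne.

Section GeneratingPoly.
Context (R : realType) (p : nat -> R) (v : R).
Hypothesis cp : critical_law p v.

Let p0 := law_ge0 cp.

(** The generating function of the offspring law, truncated at degree M so
    that it is a polynomial: below M the coefficients of its powers are those of
    the powers of the full series. *)
Definition gf (M : nat) : {poly R} := \poly_(i < M) p i.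

Lemma coef_gf M i : (gf M)`_i = if (i < M)%N then p i else 0.
Proof. by rewrite coef_poly. Qed.

Lemma coef_gf_exp_ge0 M k x : 0 <= (gf M ^+ k)`_x.
Proof.
elim: k x => [|k IH] x; first by rewrite expr0 coef1 ler0n.
rewrite exprS coefM sumr_ge0 // => i _; rewrite mulr_ge0 // coef_gf.
by case: ifP.
Qed.

Lemma coef_gf_exp_trunc M M' k x : (x < M)%N -> (x < M')%N ->
  (gf M ^+ k)`_x = (gf M' ^+ k)`_x.
Proof.
elim: k x => [|k IH] x xM xM'; first by rewrite !expr0.
rewrite !exprS !coefM; apply: eq_bigr => i _; have := ltn_ord i => ix.
by rewrite !coef_gf !ifT ?(IH (x - i)%N) //; lia.
Qed.

Lemma coef_gf_exp_words m k :
  (gf m.+1 ^+ m.+1)`_k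
    = \sum_(w : {ffun 'I_m.+1 -> 'I_m.+1} | (\sum_i w i)%N == k) weight p w.
Proof.
have -> : gf m.+1 ^+ m.+1 = \prod_(i < m.+1) \sum_(c < m.+1) p c *: 'X^c.
  by rewrite prodr_const card_ord /gf poly_def.
rewrite bigA_distr_bigA /= coef_sum [RHS]big_mkcond /=; apply: eq_bigr => w _.
rewrite scaler_prod -/(weight p w) prodrXr coefZ.
by rewrite coefXn eq_sym; case: eqP => _; rewrite ?mulr1 ?mulr0.
Qed.

Lemma coef_gf_exp_step M k x i : (i <= x)%N -> (x < M)%N ->
  p i * (gf M ^+ k)`_(x - i) <= (gf M ^+ k.+1)`_x.
Proof.
move=> ix xM; have ix' : (i < x.+1)%N by [].
rewrite exprS coefM (bigD1 (Ordinal ix')) //= coef_gf ifT; last by lia.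
rewrite lerDl sumr_ge0 // => j _; rewrite mulr_ge0 ?coef_gf_exp_ge0 // coef_gf.
by case: ifP.
Qed.

Lemma coef_gf_exp_word M (q : R) (l : seq nat) : 0 <= q ->
  {in l, forall c, q <= p c} -> (sumn l < M)%N ->
  q ^+ size l <= (gf M ^+ size l)`_(sumn l).
Proof.
move=> q0; elim: l => [|c l IH] ql lM; first by rewrite !expr0 coef1.
have := @coef_gf_exp_step M (size l) (sumn (c :: l)) c (leq_addr _ _) lM.
rewrite [in X in X <= _]/= addKn; apply: le_trans; rewrite exprS ler_pM ?exprn_ge0 //.
  by apply: ql; rewrite mem_head.
apply: IH => [c' c'l|]; first by apply: ql; rewrite inE c'l orbT.
by move: lM => /=; lia.
Qed.

(** The coefficient of degree x is nonzero only if x is a sum of letters of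
    positive probability. *)
Lemma coef_gf_exp_dvd M h k x : (forall i, 0 < p i -> (h %| i)%N) ->
  (gf M ^+ k)`_x != 0 -> (h %| x)%N.
Proof.
move=> hp; elim: k x => [|k IH] x.
  by rewrite expr0 coef1; case: x => [|x]; rewrite ?dvdn0 ?eqxx.
rewrite exprS coefM; apply: contraNT => hx; rewrite big1 // => i _.
rewrite coef_gf; case: ifP => _; last by rewrite mul0r.
have [->|pi] := eqVneq (p i) 0; first by rewrite mul0r.
have [->|g0] := eqVneq ((gf M ^+ k)`_(x - i)) 0; first by rewrite mulr0.
have hi : (h %| i)%N by apply: hp; rewrite lt_neqAle eq_sym pi p0.
have ix : (i <= x)%N by rewrite -ltnS.
have hx1 : (h %| i + (x - i))%N by rewrite dvdn_add ?hi ?(IH _ g0).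
by move: hx; rewrite -[x in ~~ (_ %| x)%N](subnKC ix) hx1.
Qed.

Lemma gf_at1 M : (gf M).[1] = \sum_(i < M) p i. Proof. exact: poly_at1. Qed.
Lemma gf_deriv_at1 M : (gf M)^`().[1] = \sum_(i < M) p i * i%:R.
Proof. exact: deriv_at1. Qed.
Lemma gf_deriv2_at1 M : (gf M)^`()^`().[1] = \sum_(i < M) p i * (i * i.-1)%:R.
Proof. exact: deriv2_at1. Qed.

(** The second moment of the sum of k.+1 letters about its mean k.+1, read off
    from the first two derivatives at 1. *)
Lemma centered_square_moment M k (g := gf M ^+ k.+1) :
  \sum_(a < size g) g`_a * (a%:R - k.+1%:R) ^+ 2
  = g^`()^`().[1] + g^`().[1] - 2 * k.+1%:R * g^`().[1] + k.+1%:R ^+ 2 * g.[1].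
Proof.
have -> : g^`()^`().[1] = \sum_(a < size g) g`_a * (a * a.-1)%:R.
  by rewrite -deriv2_at1 coefK.
have -> : g^`().[1] = \sum_(a < size g) g`_a * a%:R.
  by rewrite -deriv_at1 coefK.
have -> : g.[1] = \sum_(a < size g) g`_a by rewrite -poly_at1 coefK.
rewrite !mulr_sumr -!big_split /= -sumrB -big_split /=.
apply: eq_bigr => -[[|a] ?] _ /=; rewrite ?natrM; rewrite -?natr1; ring.
Qed.

(** Chebyshev's inequality for the sum of k letters.  The truncation makes
    the law slightly defective; M is taken so large, depending on k, that the
    defect costs less than the mass that Chebyshev leaves. *)
Lemma window_mass k T : (0 < k)%N -> 0 <= v -> 4 * k%:R * (v + 1) <= T ->
  exists M0, forall M, (M0 <= M)%N ->
    1 / 2 <= \sum_(a < size (gf M ^+ k) | (a%:R - k%:R) ^+ 2 <= T) (gf M ^+ k)`_a.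
Proof.
case: k => // k _ v0 hT.
set K : R := k.+1%:R in hT *.
have K1 : 1 <= K by rewrite /K -natr1 lerDr.
(* A defect e of the mass and the mean of one letter shifts the second
   moment of K letters about K by at most 2 K^3 e = K / 2, within the margin K
   that the 1 in v + 1 leaves. *)
pose e : R := 1 / (4 * K ^+ 2).
have K20 : 0 < 4 * K ^+ 2 by nra.
have e0 : 0 < e by rewrite divr_gt0.
have eK : K * (K * e) = 1 / 4 by rewrite /e; field; lra.
have e1 : e <= 1 by nra.
have [M1 hM1] := law_mass_lim cp e0.
have [M2 hM2] := law_mean_lim cp e0.
exists (maxn M1 M2) => M; rewrite geq_max => /andP [/hM1 hA /hM2 hb].
set A := \sum_(i < M) p i in hA; set b := \sum_(i < M) p i * i%:R in hb.
have A1 : A <= 1 := law_mass_le1 cp M.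
have b1 : b <= 1 := law_mean_le1 cp M.
set g := gf M ^+ k.+1.
have g0 a : 0 <= g`_a by exact: coef_gf_exp_ge0.
have gA : g.[1] = A ^+ k.+1 by rewrite horner_exp gf_at1.
have gb : g^`().[1] = K * (b * A ^+ k).
  by rewrite /g deriv_exp /= hornerMn hornerM horner_exp gf_at1 gf_deriv_at1 -/A
    -/b /K mulr_natl.
have Ak1 j : A ^+ j <= 1 by rewrite exprn_ile1 // (le_trans _ hA) // subr_ge0.
have A0 : 0 <= A by apply: le_trans hA; rewrite subr_ge0.
have b0 : 0 <= b by apply: le_trans hb; rewrite subr_ge0.
have bern := @bernoulli_ineq _ e k.+1; rewrite (ltW e0) e1 in bern.
have {}bern := bern isT.
have Abig : 3 / 4 <= A ^+ k.+1.
  apply: (@le_trans _ _ ((1 - e) ^+ k.+1)).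
    by apply: le_trans bern; rewrite -/K; nra.
  by rewrite lerXn2r ?nnegrE // subr_ge0.
have bbig : 1 - K * e <= b * A ^+ k.
  apply: le_trans bern _; rewrite exprS ler_pM ?exprn_ge0 ?subr_ge0 //.
  by rewrite lerXn2r ?nnegrE // subr_ge0.
have g2 : g^`()^`().[1] <= K * v + K * (K - 1).
  have -> : g^`()^`().[1] = K * ((gf M)^`()^`().[1] * A ^+ k)
     + K * (b * (gf M ^+ k)^`().[1]).
    rewrite /g deriv_exp /= derivMn derivM hornerMn hornerD !hornerM horner_exp.
    by rewrite gf_at1 gf_deriv_at1 -/A -/b /K -mulrDr mulr_natl.
  have K0 : 0 <= K by lra.
  have B2 : (gf M)^`()^`().[1] <= v by rewrite gf_deriv2_at1; apply:
    law_factorial2_le cp M.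
  rewrite lerD // ler_wpM2l //.
    by apply: (@le_trans _ _ (v * A ^+ k)); [rewrite ler_wpM2r ?exprn_ge0|rewrite
      ler_piMr].
  have gk : (gf M ^+ k)^`().[1] <= K - 1.
    rewrite deriv_exp hornerMn hornerM horner_exp gf_at1 gf_deriv_at1 -/A -/b.
    rewrite /K -natr1 addrK -[leRHS]mulr1 -mulr_natl ler_wpM2l //.
    by rewrite mulr_ile1 ?exprn_ge0.
  apply: (@le_trans _ _ (b * (K - 1))); first by rewrite ler_wpM2l.
  by rewrite ler_piMl // subr_ge0.
have sq : \sum_(a < size g) g`_a * (a%:R - K) ^+ 2 =
    g^`()^`().[1] + g^`().[1] - 2 * K * g^`().[1] + K ^+ 2 * g.[1].
  exact: centered_square_moment.
rewrite gb gA in sq.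
have {}sq : \sum_(a < size g) g`_a * (a%:R - K) ^+ 2 <= K * (v + 1).
  rewrite sq; have := Ak1 k.+1; set y := A ^+ k.+1; set x := b * A ^+ k in bbig *.
  move=> y1.
  have : K ^+ 2 * y <= K ^+ 2 by rewrite ler_piMr ?sqr_ge0.
  have : (2 * K - 1) * K * (1 - K * e) <= (2 * K - 1) * K * x.
    by rewrite ler_wpM2l //; nra.
  have : (2 * K - 1) * K * (1 - K * e) = (2 * K - 1) * K - (2 * K - 1) * (1/4).
    by rewrite -eK; ring.
  nra.
have tot : g.[1] = \sum_(a < size g) g`_a by rewrite -{1}(coefK g) poly_at1.
rewrite gA in tot; rewrite tot (bigID (fun a : 'I__ => (a%:R - K) ^+ 2 <= T)) /=
  in Abig.
have T0 : 0 < T by apply: lt_le_trans hT; nra.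
have : T * \sum_(i < size g | ~~ ((i%:R - K) ^+ 2 <= T)) g`_i <= K * (v + 1).
  apply: le_trans sq; rewrite mulr_sumr big_mkcond /=; apply: ler_sum => a _.
  case: ifP => [|_]; last by rewrite mulr_ge0 ?sqr_ge0.
  by rewrite -ltNge => /ltW h; rewrite mulrC ler_wpM2l.
set bad := \sum_(i < size g | ~~ _) _ in Abig * => hbad.
have : bad <= 1 / 4.
  by rewrite -(ler_pM2l T0); apply: le_trans hbad _; lra.
by move: Abig; lra.
Qed.

Section Span.
Variables (h r : nat).
Hypothesis r2 : (2 <= r)%N.
Hypothesis pr : 0 < p r.
Hypothesis pz : 0 < p 0%N.
Hypothesis h_dvd : forall i, 0 < p i -> (h %| i)%N.
Hypothesis h_max : forall g, (forall i, 0 < p i -> (g %| i)%N) -> (g <= h)%N.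

Let supp (c : nat) : bool := 0 < p c.

Let sum_class (d : nat) : Prop :=
  exists2 l, all supp l & sumn l = d %[mod r].

Lemma sum_class_add a b : sum_class a -> sum_class b -> sum_class (a + b).
Proof.
move=> [l sl el] [l' sl' el']; exists (l ++ l'); first by rewrite all_cat sl.
by rewrite sumn_cat -modnDm el el' modnDm.
Qed.

Lemma sum_class_mul c a : sum_class a -> sum_class (c * a).
Proof.
move=> sa; elim: c => [|c IH]; first by exists [::].
by rewrite mulSn; apply: sum_class_add.
Qed.

Lemma sum_class_mod a b : a = b %[mod r] -> sum_class a -> sum_class b.
Proof. by move=> ab [l sl el]; exists l => //; rewrite el. Qed.

(** The residues modulo r of sums of possible letters form a subgroup, because
    r itself is a possible letter.  Its least positive element divides every
    possible letter, hence is the span. *)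
Lemma sum_class_span : sum_class h.
Proof.
have exD : exists d, `[< (0 < d)%N /\ sum_class d >].
  by exists r; apply/asboolP; split; [lia|exists [:: r]; rewrite /= ?andbT // addn0].
have [g /asboolP [g0 sg] gmin] := ex_minnP exD.
have g_dvd d : sum_class d -> (g %| d)%N.
  move=> sd; rewrite /dvdn; apply/eqP; case: (posnP (d %% g)) => // pos.
  have : (g <= d %% g)%N.
    apply: gmin; apply/asboolP; split => //.
    apply: (@sum_class_mod (d + (r.-1 * (d %/ g)) * g)).
      have -> : (d + (r.-1 * (d %/ g)) * g = (d %/ g * g) * r + d %% g)%N.
        have dE := divn_eq d g.
        by rewrite {1}dE -{2}(prednK (ltnW r2)) mulnS; nia.
      by rewrite modnMDl.
    by apply: sum_class_add => //; apply: sum_class_mul.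
  by rewrite leqNgt ltn_mod g0.
have gh : (g <= h)%N.
  apply: h_max => i pi; apply: g_dvd; exists [:: i]; rewrite /= ?addn0 //.
  by rewrite andbT.
have hg : (h %| g)%N.
  have [l sl el] := sg.
  have hl : (h %| sumn l)%N.
    elim: l sl {el} => //= c l IH /andP [sc sl]; rewrite dvdn_add ?IH //.
    exact: h_dvd.
  have hr := h_dvd pr.
  have : (h %| g %% r)%N by rewrite -el /dvdn modn_dvdm // -/(dvdn _ _).
  by rewrite /dvdn modn_dvdm.
suff -> : h = g by [].
by apply/eqP; rewrite eqn_leq gh andbT dvdn_leq.
Qed.

Lemma support_lower_bound (l : seq nat) : all supp l ->
  exists q, [/\ 0 < q, q <= 1 & {in l, forall c, q <= p c}].
Proof.
elim: l => [|c l IH] /=; first by exists 1.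
move=> /andP [sc /IH [q [q0 q1 hq]]]; exists (Num.min q (p c)); split.
- by rewrite lt_min q0.
- by rewrite ge_min q1.
- by move=> c'; rewrite inE => /orP [/eqP ->|/hq]; rewrite ge_min ?lexx ?orbT // => ->.
Qed.

(** One word per residue class modulo r, followed by copies of r and padded
    with zeros, reaches every large multiple x of h in L letters.  At most
    x / 2 copies of r are used, which leaves room for x to exceed L. *)
Lemma span_completion : exists (C : nat) (q : R), [/\ 0 < q, q <= 1 &
  forall L x M, (h %| x)%N -> (C <= x)%N -> (x + 2 * C <= 2 * L)%N -> (x < M)%N ->
    q ^+ L <= (gf M ^+ L)`_x].
Proof.
have exl (d : 'I_r) : exists l, (h %| d)%N -> all supp l /\ sumn l = d %[mod r].
  have [/dvdnP [c ->]|] := boolP (h %| d)%N; last by exists [::].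
  by have [l sl el] := sum_class_mul c sum_class_span; exists l.
have [lf hlf] := choice exl.
pose C := (\sum_(d < r) (sumn (lf d) + size (lf d)))%N.
pose letters := flatten [seq lf d | d <- [seq d : 'I_r <- enum 'I_r | (h %| d)%N]].
have [q [q0 q1 hq]] : exists q, [/\ 0 < q, q <= 1 & {in 0%N :: r :: letters,
  forall c, q <= p c}].
  apply: support_lower_bound; rewrite /= /supp pz pr /=.
  apply/allP => c /flatten_mapP [d]; rewrite mem_filter => /andP [hd _].
  by have [/allP sl _] := hlf d hd; apply: sl.
exists C, q; split=> // L x M hx Cx xL xM.
have r0 : (0 < r)%N by lia.
pose d := Ordinal (ltn_pmod x r0).
have hd : (h %| d)%N by rewrite /dvdn /= modn_dvdm ?h_dvd.
have [_ el] := hlf d hd.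
have Cd : (sumn (lf d) + size (lf d) <= C)%N by rewrite /C (bigD1 d) //= leq_addr.
have := divn_eq (x - sumn (lf d)) r.
have -> : ((x - sumn (lf d)) %% r = 0)%N.
  by apply/eqP; rewrite -/(dvdn _ _) -eqn_mod_dvd ?el /= ?modn_mod //; lia.
set j := (_ %/ r)%N; rewrite addn0 => xE.
have jr : (2 * j <= j * r)%N by rewrite mulnC leq_mul2l r2 orbT.
pose l := nseq (L - (size (lf d) + j)) 0%N ++ nseq j r ++ lf d.
have sl : size l = L by rewrite !size_cat !size_nseq; lia.
have suml : sumn l = x by rewrite !sumn_cat !sumn_nseq mul0n; lia.
rewrite -[in q ^+ _]sl -sl -suml; apply: coef_gf_exp_word; rewrite ?suml //.
  exact: ltW.
move=> c; rewrite !mem_cat => /or3P [/nseqP [-> _]|/nseqP [-> _]|cl].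
- by apply: hq; rewrite inE eqxx.
- by apply: hq; rewrite !inE eqxx orbT.
- apply: hq; rewrite !inE; apply/orP; right; apply/orP; right.
  by apply/flatten_mapP; exists d => //; rewrite mem_filter hd mem_enum.
Qed.

Definition word_mass (m : nat) : R :=
  \sum_(w : {ffun 'I_m.+1 -> 'I_m.+1} | (\sum_i w i)%N == m) weight p w.

(** For W of order n^(1/2) this is a lower bound of the form
    exp(- C n^(1/2)) for the probability that n letters sum to n - 1. *)
Lemma word_mass_lower_bound : exists (C : nat) (q : R), [/\ 0 < q, q <= 1 &
  forall m W, (h %| m)%N -> 4 * m.+1%:R * (v + 1) <= W%:R ^+ 2 :> R ->
    (W + C < m)%N -> q ^+ (W + C) / 2 <= word_mass m].
Proof.
have v0 : 0 <= v.
  by apply: le_trans (law_factorial2_le cp 0); rewrite big_ord0.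
have [C [q [q0 q1 hC]]] := span_completion.
(* With L = W + 2 C + 1, a remainder between L - 1 - W and L - 1 + W
   satisfies both requirements of the completion lemma. *)
exists (2 * C + 1)%N, q; split=> // m W hm hW Wm.
set L := (W + (2 * C + 1))%N in Wm *.
(* The first k letters land in the window, the last L complete the sum to
   m. *)
pose k := (m.+1 - L)%N.
have k0 : (0 < k)%N by rewrite /k; lia.
have kT : 4 * k%:R * (v + 1) <= W%:R ^+ 2 :> R.
  apply: le_trans hW; rewrite ler_wpM2r ?addr_ge0 // ler_wpM2l //.
  by rewrite ler_nat /k; lia.
have [M0 hM0] := window_mass k0 v0 kT.
pose M := maxn M0 m.+1.
have /hM0 hwin : (M0 <= M)%N by rewrite leq_maxl.
rewrite /word_mass -coef_gf_exp_words (@coef_gf_exp_trunc _ M) //; last first.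
  by rewrite /M; lia.
have -> : gf M ^+ m.+1 = gf M ^+ k * gf M ^+ L by rewrite -exprD /k subnK //; lia.
rewrite coefM -[_ / 2]mulrC -[2^-1]mul1r.
apply: le_trans (ler_wpM2r (exprn_ge0 L (ltW q0)) hwin) _.
have win (a : nat) : (a%:R - k%:R) ^+ 2 <= W%:R ^+ 2 :> R -> (a <= k + W)%N /\ (k
  <= a + W)%N.
  rewrite -ler_sqrt ?sqr_ge0 // !sqrtr_sqr [`|W%:R|]ger0_norm // ler_norml =>
    /andP [h1 h2].
  by rewrite -!(ler_nat R) !natrD; lra.
rewrite mulr_suml.
set g := gf M ^+ k.
have gL0 a : 0 <= g`_a * (gf M ^+ L)`_(m - a).
  by rewrite mulr_ge0 ?coef_gf_exp_ge0.
have step (a : nat) : (a%:R - k%:R) ^+ 2 <= W%:R ^+ 2 :> R ->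
    g`_a * q ^+ L <= g`_a * (gf M ^+ L)`_(m - a).
  move=> /win [a1 a2]; have [->|ga] := eqVneq (g`_a) 0; first by rewrite !mul0r.
  rewrite ler_wpM2l ?coef_gf_exp_ge0 //; apply: hC.
  - by rewrite dvdn_sub // (coef_gf_exp_dvd h_dvd ga).
  - by rewrite /k /L in a1 a2; lia.
  - by rewrite /k /L in a1 a2; lia.
  - by rewrite /M; lia.
apply: le_trans (ler_sum _ (fun a ha => step _ ha)) _.
rewrite (big_ord_widen_cond (maxn (size g) m.+1) (fun a : nat => (a%:R - k%:R) ^+
  2 <= W%:R ^+ 2)
  (fun a => g`_a * (gf M ^+ L)`_(m - a))) ?leq_maxl //.
rewrite [leRHS](big_ord_widen (maxn (size g) m.+1) 
  (fun a => g`_a * (gf M ^+ L)`_(m - a))) ?leq_maxr //.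
rewrite big_mkcond [leRHS]big_mkcond /=; apply: ler_sum => a _.
case: ifP => [/andP [/win [a1 a2] _]|_]; last by case: ifP.
by rewrite ifT //; rewrite /k /L in a1; lia.
Qed.

End Span.
End GeneratingPoly.

(** * From the Galton-Watson process to word sums *)

Definition outdegree_at (t : plane_tree) (v : seq nat) : nat :=
  if fringe_at t v is Some s then size (children s) else 0%N.

(** Listing the addresses in preorder makes the product over the nodes of t
    the product over the letters of its word. *)
Lemma node_addresses t : exists l : seq (seq nat), [/\ uniq l,
  forall v, (v \in l) = isSome (fringe_at t v)
  & [seq outdegree_at t v | v <- l] = preorder t].
Proof.
pose PF ts := exists l : seq (nat * seq nat), [/\ uniq l,
  forall i v, ((i, v) \in l) = isSome (obind (fringe_at^~ v) (onth ts i))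
  & [seq outdegree_at (Node ts) (q.1 :: q.2) | q <- l] = forest_code ts].
move: t; refine (@plane_tree_forest_ind _ PF _ _ _).
- move=> ts [l [ul ml el]].
  have cons_inj : injective (fun q : nat * seq nat => q.1 :: q.2).
    by move=> [i v] [j w] /= [-> ->].
  exists ([::] :: [seq q.1 :: q.2 | q <- l]); split.
  + rewrite /= map_inj_uniq ?ul ?andbT //; apply/mapP => -[q _] //.
  + case=> [|i v] //; rewrite inE orFb -[_ :: _]/((i, v).1 :: (i, v).2).
    by rewrite (mem_map cons_inj) ml /=; case: (onth ts i).
  + by rewrite preorderE /= -map_comp el.
- by exists [::]; split=> // i v; case: i.
- move=> t ts [l [ul ml el]] [l' [ul' ml' el']].
  exists ([seq (0%N, v) | v <- l] ++ [seq (q.1.+1, q.2) | q <- l']); split.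
  + rewrite cat_uniq !map_inj_uniq ?ul ?ul' ?andbT //=; first 1 last.
    * by move=> [i v] [j w] /= [-> ->].
    * by move=> v w [].
    by apply/hasPn => _ /mapP [q _ ->]; apply/mapP => -[].
  + have S_inj : injective (fun q : nat * seq nat => (q.1.+1, q.2)).
      by move=> [i v] [j w] /= [-> ->].
    have Z_inj : injective (fun v : seq nat => (0%N, v)) by move=> v w [].
    case=> [|i] v; rewrite mem_cat.
      rewrite (mem_map Z_inj) ml /= [X in _ || X](_ : _ = false) ?orbF //.
      by apply/mapP => -[].
    rewrite [X in X || _](_ : _ = false); last by apply/mapP => -[].
    by rewrite -[(_, _)]/((i, v).1.+1, (i, v).2) (mem_map S_inj) ml'.
  + by rewrite map_cat -!map_comp forest_code_cons -el -el'.
Qed.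

(** The part of [generates] that depends only on the outcome's family of
    outdegrees. *)
Definition follows (f : seq nat -> nat) (t : plane_tree) : Prop :=
  forall v s, fringe_at t v = Some s -> f v = size (children s).

Lemma follows_uniq f t t' : follows f t -> follows f t' -> t = t'.
Proof.
pose PF ts := forall us f, size ts = size us ->
  (forall i t, onth ts i = Some t -> follows (fun v => f (i :: v)) t) ->
  (forall i t, onth us i = Some t -> follows (fun v => f (i :: v)) t) -> ts = us.
move: t f t'; refine (@plane_tree_forest_ind _ PF _ _ _).
- move=> ts IH f [us] ft fu; congr Node; apply: (IH us f).
  + exact: etrans (esym (ft [::] _ erefl)) (fu [::] _ erefl).
  + by move=> i t ti v s sv; apply: (ft (i :: v)); rewrite /= ti.
  + by move=> i t ti v s sv; apply: (fu (i :: v)); rewrite /= ti.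
- by case.
- move=> t ts IHt IHts [//|u us] f /= [su] ft fu; congr cons.
    by apply: (IHt _ u (ft 0%N t erefl) (fu 0%N u erefl)).
  apply: (IHts us (fun v => if v is i :: v' then f (i.+1 :: v') else 0%N) su).
    by move=> i; apply: (ft i.+1).
  by move=> i; apply: (fu i.+1).
Qed.

Definition tree_of (m : nat) (w : {ffun 'I_m.+1 -> 'I_m.+1}) : plane_tree :=
  head (Node [::]) (parse (letters w)).

Lemma preorder_tree_of m (w : {ffun 'I_m.+1 -> 'I_m.+1}) :
  luk (letters w) -> preorder (tree_of w) = letters w.
Proof.
move=> /luk_preorder_parse [t e].
by rewrite /tree_of -e -{1}[preorder t]cats0 parse_preorder_cat.
Qed.

Lemma letters_preorder m t : tsize t = m.+1 ->
  exists w : {ffun 'I_m.+1 -> 'I_m.+1},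
    [/\ letters w = preorder t, luk (letters w) & tree_of w = t].
Proof.
move=> tm; have [||w e] := @letters_surj m (preorder t).
- by rewrite size_preorder.
- have /lukP [sp _] := luk_preorder t.
  have le_sumn c : c \in preorder t -> (c <= sumn (preorder t))%N.
    by case/splitPr => s1 s2; rewrite sumn_cat /=; lia.
  apply/allP => c /le_sumn; move: sp; rewrite size_preorder tm.
  by move=> [->].
exists w; rewrite e luk_preorder; split=> //.
by rewrite /tree_of e -[preorder t]cats0 parse_preorder_cat.
Qed.

Section Law.
Context (R : realType) (d : measure_display) (Omega : measurableType d)
  (P : probability Omega R).
Variable xi : {RV P >-> nat}.
Local Notation p := (offspring_prob xi).

Lemma measurable_RV_nat (X : {RV P >-> nat}) (B : set nat) : measurable (X @^-1` B).
Proof. by rewrite -[X in measurable X]setTI; exact: measurable_funPT. Qed.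

Lemma offspring_probE i : P (xi @^-1` [set i]) = (p i)%:E.
Proof. by rewrite /offspring_prob fineK // fin_num_measure //; exact:
  measurable_RV_nat. Qed.

Lemma offspring_prob_ge0 i : 0 <= p i.
Proof. by rewrite /offspring_prob fine_ge0. Qed.

Lemma integral_offspring (f : nat -> R) : (forall i, 0 <= f i) ->
  (\int[P]_w (f (xi w))%:E = \sum_(0 <= i <oo) (p i * f i)%:E)%E.
Proof.
move=> f0.
have U : [set: Omega] = \bigcup_k (xi @^-1` [set k]).
  by apply/seteqP; split => w _ //; exists (xi w).
rewrite U ge0_integral_bigcup; last first.
- by apply/trivIsetP => i j _ _ ij; apply/seteqP; split=> w //= -[->] /eqP;
    rewrite (negbTE ij).
- by move=> w _; rewrite lee_fin.
- rewrite -U => _ B mB; rewrite setTI.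
  exact: (measurable_RV_nat xi (fun i => B (f i)%:E)).
- by move=> k; exact: measurable_RV_nat.
apply: eq_eseriesr => i _.
rewrite (eq_integral (cst (f i)%:E)); last by move=> w; rewrite in_setE /= => ->.
rewrite integral_cst; last exact: measurable_RV_nat.
by rewrite [X in (_ * X)%E](offspring_probE i) -EFinM mulrC.
Qed.

Lemma offspring_partial_sums (f : nat -> R) (c : R) : (forall i, 0 <= f i) ->
  (\int[P]_w (f (xi w))%:E = c%:E)%E ->
  (forall M, \sum_(i < M) p i * f i <= c) /\
  (forall e, 0 < e -> exists M0, forall M, (M0 <= M)%N ->
     c - e <= \sum_(i < M) p i * f i).
Proof.
move=> f0; rewrite integral_offspring // => hc.
have t0 i : (0 <= (p i * f i)%:E)%E by rewrite lee_fin mulr_ge0 ?offspring_prob_ge0.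
have psum M : (\sum_(0 <= i < M) (p i * f i)%:E = (\sum_(i < M) p i * f i)%:E)%E.
  by rewrite big_mkord sumEFin.
split=> [M|e e0].
  by rewrite -lee_fin -psum -hc; apply: nneseries_lim_ge => // *; exact: t0.
have : (fun M => (\sum_(0 <= i < M) (p i * f i)%:E)%E) @ \oo --> c%:E.
  by rewrite -hc; apply: is_cvg_nneseries => // *; exact: t0.
under eq_fun do rewrite psum.
move=> /fine_cvgP [_ /cvgrPdist_le /(_ e e0)] [M0 _ hM0]; exists M0 => M MM0.
by have := hM0 M MM0; rewrite /= ler_norml => /andP [_]; lra.
Qed.

Hypothesis mean1 : ('E_P[fun w => (xi w)%:R : R] = 1)%E.
Hypothesis var_fin : ('V_P[fun w => (xi w)%:R : R] < +oo)%E.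

Lemma offspring_critical : exists v, critical_law p v.
Proof.
have [m1 m2] : (forall M, \sum_(i < M) p i * i%:R <= 1) /\
  (forall e, 0 < e -> exists M0, forall M, (M0 <= M)%N ->
     1 - e <= \sum_(i < M) p i * i%:R).
  apply: (@offspring_partial_sums (fun i => i%:R)) => [i|]; first exact: ler0n.
  by move: mean1; rewrite unlock.
have [s1 s2] : (forall M, \sum_(i < M) p i * 1 <= 1) /\
  (forall e, 0 < e -> exists M0, forall M, (M0 <= M)%N ->
     1 - e <= \sum_(i < M) p i * 1).
  apply: (@offspring_partial_sums (fun=> 1)) => //.
  by rewrite integral_cst // [X in (_ * X)%E]probability_setT mule1.
have one M : \sum_(i < M) p i * 1 = \sum_(i < M) p i.
  by apply: eq_bigr => i _; rewrite mulr1.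
pose f (i : nat) : R := (i%:R - 1) ^+ 2.
have vE : ('V_P[fun w => (xi w)%:R : R] = \int[P]_w (f (xi w))%:E)%E.
  rewrite /variance covariance.unlock mean1 /= expectation.unlock.
  by apply: eq_integral => w _; rewrite /= /f expr2.
have vfin : 'V_P[fun w => (xi w)%:R : R]%E \is a fin_num.
  rewrite ge0_fin_numE // vE; apply: integral_ge0 => w _.
  by rewrite lee_fin sqr_ge0.
have [v1 _] := @offspring_partial_sums f (fine 'V_P[fun w => (xi w)%:R : R]%E)
  (fun i => sqr_ge0 _) (etrans (esym vE) (esym (fineK vfin))).
exists (fine 'V_P[fun w => (xi w)%:R : R]%E + 1); split=> //.
- exact: offspring_prob_ge0.
- by move=> M; rewrite -one.
- by move=> e /s2 [M0 h]; exists M0 => M; rewrite -one; exact: h.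
- move=> M; apply: le_trans (lerD (v1 M) (m1 M)).
  rewrite -big_split /=; apply: ler_sum => i _.
  rewrite -mulrDr ler_wpM2l ?offspring_prob_ge0 // /f.
  case: (i : nat) => [|j]; first by rewrite mul0n; lra.
  by rewrite natrM /= -natr1; have := ler0n R j; nra.
Qed.

(** Since the mean is 1, the surplus (r - 1) p_r of the letter r has to be
    balanced by the only letter below the mean, which is 0. *)
Lemma offspring_prob0_gt0 r : (2 <= r)%N -> 0 < p r -> 0 < p 0%N.
Proof.
move=> r2 pr; have [v cp] := offspring_critical.
have [M0 h] := law_mass_lim cp (divr_gt0 pr (ltr0Sn R 1)).
pose M := maxn M0 r.+1.
have MM0 : (M0 <= M)%N by rewrite leq_maxl.
have rM : (r < M)%N by rewrite leq_maxr.
have zM : (0 < M)%N by rewrite (leq_ltn_trans _ rM).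
have hm := law_mean_le1 cp M; have {h}hs := h _ MM0.
have : 0 <= \sum_(i < M) (p i * i%:R - p i + p i * (i == 0%N :> nat)%:R
    - p i * (i == r :> nat)%:R).
  apply: sumr_ge0 => i _; have pi0 := offspring_prob_ge0 i.
  have [i0|i1] := posnP i; first by rewrite i0 (ltn_eqF (ltnW r2)) /= !mulr0
    mulr1 sub0r addNr subr0.
  have i1R : 1 <= i%:R :> R by rewrite ler1n.
  have [ir|_] := eqVneq (i : nat) r; last by rewrite /=; nra.
  have i2R : 2 <= i%:R :> R by rewrite ler_nat ir.
  by rewrite /=; nra.
rewrite sumrB big_split /= sumrB !sum_pick //; lra.
Qed.

End Law.

Section GWLaw.
Context (R : realType) (d : measure_display) (Omega : measurableType d)
  (P : probability Omega R).
Variables (xi : {RV P >-> nat}) (xi_ : seq nat -> {RV P >-> nat}).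
Hypothesis iid : iid_copies xi xi_.
Local Notation p := (offspring_prob xi).

(** Independence of the outdegrees at the finitely many nodes of t. *)
Lemma gw_event_tree t (E := gw_event xi_ [set t]) :
  measurable E /\ P E = (\prod_(c <- preorder t) p c)%:E.
Proof.
have [l [ul ml el]] := node_addresses t.
have -> : E = \bigcap_(v in [set` l]) (xi_ v @^-1` [set outdegree_at t v]).
  apply/seteqP; split => [w [_ -> gt] v|w gt].
    rewrite /= ml; case e: (fringe_at t v) => [s|//] _.
    by rewrite /outdegree_at e; exact: gt.
  exists t => // v s e; have := gt v; rewrite /= ml e /outdegree_at e => -> //.
have [indep same_law] := iid; split.
  apply: fin_bigcap_measurable => [|v _]; last exact: measurable_RV_nat.
  exact: finite_seq.
rewrite (indep l (fun v => [set outdegree_at t v])) // -el big_map -prodEFin.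
by apply: eq_bigr => v _; rewrite same_law // offspring_probE.
Qed.

Lemma gw_event_size m (A : set plane_tree) :
  P (gw_event xi_ (A `&` [set t | tsize t = m.+1]))
    = (\sum_(w : {ffun 'I_m.+1 -> 'I_m.+1} |
         luk (letters w) && `[< A (tree_of w) >]) weight p w)%:E.
Proof.
pose b : pred {ffun 'I_m.+1 -> 'I_m.+1} := fun w =>
  luk (letters w) && `[< A (tree_of w) >].
pose D := [set w | b w].
have inD w : (w \in D) = b w by apply/idP/idP; rewrite in_setE.
have -> : gw_event xi_ (A `&` [set t | tsize t = m.+1])
  = \bigcup_(w in D) gw_event xi_ [set tree_of w].
  apply/seteqP; split => [x [t [At tm] gt]|x [w /andP [lw /asboolP Aw] [_ -> gt]]].
    have [w [ew lw tw]] := letters_preorder tm.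
    by exists w; [apply/andP; split => //; apply/asboolP; rewrite tw|exists t].
  exists (tree_of w) => //; split=> //=.
  by rewrite -size_preorder preorder_tree_of // size_letters.
have fD : finite_set D by exact: finite_finset.
rewrite measure_fin_bigcup //; first last.
- by move=> w _; have [] := gw_event_tree (tree_of w).
- move=> w w' /andP [lw _] /andP [lw' _] [x [[_ -> g] [_ -> g']]].
  apply: letters_inj; rewrite -(preorder_tree_of lw) -(preorder_tree_of lw').
  congr preorder.
  exact: (@follows_uniq (fun v => xi_ v x)).
rewrite (@fsbigE _ _ _ _ _ (enum b)); last 3 first.
- exact: enum_uniq.
- by move=> w; rewrite /= mem_enum.
- by move=> w Dw; rewrite mem_enum => /negP.
rewrite big_enum_cond -sumEFin; apply: eq_big => [w|w].
  by rewrite inD andbb.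
rewrite inD andbb => /andP [lw _].
have [_ e] := gw_event_tree (tree_of w); apply: etrans e _.
by rewrite preorder_tree_of // /letters big_map big_enum.
Qed.

Lemma cgw_probE m (A : set plane_tree) :
  cgw_prob xi_ m.+1 A
    = (\sum_(w : {ffun 'I_m.+1 -> 'I_m.+1} |
         luk (letters w) && `[< A (tree_of w) >]) weight p w)
      / (\sum_(w : {ffun 'I_m.+1 -> 'I_m.+1} | luk (letters w)) weight p w).
Proof.
rewrite /cgw_prob gw_event_size; congr (_ / _).
have := gw_event_size m setT; rewrite setTI => -> /=.
by apply: eq_bigl => w; rewrite asboolT ?andbT.
Qed.

End GWLaw.

(** * Words with and without an occurrence of a given tree *)

Section Hit.
Context (R : realType) (m : nat) (p : nat -> R).
Local Notation n := m.+1.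
Local Notation word := {ffun 'I_n -> 'I_n}.

Definition hit_mass (s : plane_tree) : R :=
  \sum_(w : word | ((\sum_i w i)%N == m) && [exists i, occ (preorder s) w i])
    weight p w.

Lemma sum_letters_shift d (w : word) : (\sum_i shift d w i = \sum_i w i)%N.
Proof.
rewrite [RHS](reindex_inj (addrI d)).
by apply: eq_bigr => i _; rewrite ffunE.
Qed.

Lemma weight_shift d (w : word) : weight p (shift d w) = weight p w.
Proof.
rewrite /weight [RHS](reindex_inj (addrI d)).
by apply: eq_bigr => i _; rewrite ffunE.
Qed.

Lemma exists_occ_shift u d (w : word) :
  [exists i, occ u (shift d w) i] = [exists i, occ u w i].
Proof.
apply/existsP/existsP => -[i]; rewrite ?occ_shift => oi.
  by exists (d + i).
by exists (i - d); rewrite occ_shift addrCA subrr addr0.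
Qed.

Lemma luk_sum (w : word) : luk (letters w) -> (\sum_i w i)%N = m.
Proof. by move=> /lukP []; rewrite sumn_letters size_letters => -[->]. Qed.

Lemma luk_mass (B : pred word) : (forall d (w : word), B (shift d w) = B w) ->
  \sum_(w : word | ((\sum_i w i)%N == m) && B w) weight p w
    = n%:R * \sum_(w : word | luk (letters w) && B w) weight p w.
Proof.
move=> Bs.
pose G (w : word) := if ((\sum_i w i)%N == m) && B w then weight p w else 0.
rewrite big_mkcond -/(G _) /= (@sum_luk _ _ G).
- congr (_ * _); rewrite [RHS]big_mkcondr; apply: eq_bigr => w /luk_sum wm.
  by rewrite /G wm eqxx.
- by move=> d w; rewrite /G sum_letters_shift Bs weight_shift.
- by move=> w /negbTE wm; rewrite /G wm.
Qed.

Variables (r : nat) (s : plane_tree) (eta q : R).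
Hypothesis p0 : forall c, 0 <= p c.
Hypothesis p1 : \sum_(c < n) p c <= 1.
Hypothesis rn : (r < n)%N.
Hypothesis q0 : 0 < q.
Hypothesis qz : q <= p 0%N.
Hypothesis qr : q <= p r.
Hypothesis sr : {in preorder s, forall c, c \in [:: 0%N; r]}.
Hypothesis eta0 : 0 < eta.
Hypothesis eta1 : eta <= 1.
Hypothesis sn : (2 * tsize s)%:R <= n%:R * eta * q / 4.
Hypothesis seta : (2 * tsize s)%:R * eta <= 1 / 3.

Let u := preorder s.
Let k := tsize s.
Let pi := \prod_(c <- u) p c.
Let delta := eta * q / 4.

(** The tolerance delta is proportional to eta q, where q bounds p_0 and p_r
    from below, so that it amounts to a relative error of order eta. *)
Definition typical (w : word) : bool :=
  (`|(cnt 0 w)%:R - n%:R * p 0%N| <= n%:R * delta) &&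
  (`|(cnt r w)%:R - n%:R * p r| <= n%:R * delta).

Let F (w : word) : R :=
  weight p w * (((\sum_i w i)%N == m) && typical w)%:R.

Lemma typical_weight_exchangeable : exchangeable F.
Proof.
move=> t w; rewrite /F /typical !cnt_perm; congr (_ * _%:R).
  rewrite /weight [RHS](reindex_inj (@perm_inj _ t)).
  by apply: eq_bigr => i _; rewrite ffunE.
congr (nat_of_bool ((_ == _) && _)); rewrite [RHS](reindex_inj (@perm_inj _ t)).
by apply: eq_bigr => i _; rewrite ffunE.
Qed.

Lemma typical_weight_ge0 w : 0 <= F w. Proof. by rewrite mulr_ge0 ?weight_ge0. Qed.

Lemma lower_prob_le1 : q <= 1.
Proof.
apply: le_trans qz _; apply: le_trans p1.
by rewrite (bigD1 ord0) //= lerDl sumr_ge0.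
Qed.

Lemma typical_draw (w : word) : F w != 0 -> forall c a b : nat, c \in u ->
  (a <= b)%N -> (b < 2 * k)%N ->
  p c * (1 - eta) <= ((cnt c w)%:R - a%:R) / (n%:R - b%:R) <= p c * (1 + eta).
Proof.
move=> Fw c a b cu ab bk.
have /andP [tz tr] : typical w.
  by apply: contraNT Fw => /negbTE tw; rewrite /F tw andbF mulr0.
have [qc hc] : q <= p c /\ `|(cnt c w)%:R - n%:R * p c| <= n%:R * delta.
  by have := sr cu; rewrite !inE => /orP [] /eqP ->.
have bR : b%:R <= n%:R * eta * q / 4 :> R.
  by apply: le_trans sn; rewrite ler_nat ltnW.
have aR : a%:R <= b%:R :> R by rewrite ler_nat.
have a0 : 0 <= a%:R :> R by [].
have n0 : 0 < n%:R :> R by [].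
move: hc; rewrite ler_norml /delta => /andP [h1 h2].
have q1 := lower_prob_le1.
have E : n%:R * eta * q <= n%:R * eta * p c by rewrite ler_wpM2l // mulr_ge0 // ltW.
have E2 : n%:R * eta * q <= n%:R * eta by rewrite ler_piMr // mulr_ge0 // ltW.
have E3 : n%:R * eta <= n%:R by rewrite ler_piMr // ltW.
have nb : 0 < n%:R - b%:R :> R by lra.
have pc0 := p0 c.
rewrite ler_pdivlMr // ler_pdivrMr //; apply/andP; split.
  apply: (@le_trans _ _ (p c * (1 - eta) * n%:R)).
    rewrite ler_wpM2l ?mulr_ge0 ?subr_ge0 //; lra.
  lra.
have H : b%:R <= n%:R * (eta / 4) by nra.
apply: (@le_trans _ _ (p c * (1 + eta) * (n%:R - n%:R * (eta / 4)))); last first.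
  rewrite ler_wpM2l ?mulr_ge0 ?addr_ge0 // ?(ltW eta0) //; lra.
have : 0 <= p c * n%:R * (eta * (1 - eta)) by rewrite !mulr_ge0 // ?subr_ge0 // ltW.
nra.
Qed.

Lemma pattern_size_le : (k <= n)%N.
Proof.
have q1 := lower_prob_le1; have n0 : 0 < n%:R :> R by [].
have E2 : n%:R * eta * q <= n%:R * eta by rewrite ler_piMr // mulr_ge0 // ltW.
have E3 : n%:R * eta <= n%:R by rewrite ler_piMr // ltW.
rewrite -(ler_nat R); have := sn; rewrite natrM -/k; have := ler0n R k; lra.
Qed.

Let theta : R := 4 * k%:R * eta.

Lemma slack_ge0 : 0 <= theta. Proof. by rewrite !mulr_ge0 // ltW. Qed.
Lemma slack_le1 : theta <= 1.
Proof. by have := seta; rewrite natrM /theta -/k; lra. Qed.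

Lemma pow_1B_ge : 1 - theta <= (1 - eta) ^+ k.
Proof.
apply: le_trans (@bernoulli_ineq _ eta k _); last by rewrite ltW.
by have := slack_ge0; rewrite /theta; lra.
Qed.

Lemma pow_1D_sqr_le : ((1 + eta) ^+ k) ^+ 2 <= 1 + theta.
Proof.
apply: (@le_trans _ _ (expR ((2 * k)%:R * eta))).
  rewrite -exprM mulnC expRM_natl lerXn2r ?nnegrE ?expR_ge0 ?expR_ge1Dx //.
  by rewrite addr_ge0 // ltW.
have x0 : 0 <= (2 * k)%:R * eta by rewrite mulr_ge0 // ltW.
apply: le_trans (expR_le_quadratic _) _; first by rewrite ger0_norm.
have -> : theta = 2 * ((2 * k)%:R * eta) by rewrite /theta natrM; ring.
by have := seta; rewrite -/k; nra.
Qed.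

Lemma pow_1D_le : (1 + eta) ^+ k <= 1 + theta.
Proof.
apply: le_trans pow_1D_sqr_le; rewrite expr2 ler_peMl ?exprn_ge0 ?exprn_ege1 //.
  by rewrite addr_ge0 // ltW.
by rewrite lerDl ltW.
Qed.

Let X := \sum_w F w.
Let B : R := 4 * expR (- (n%:R * delta ^+ 2 / 4)).

Lemma typical_mass_le : X <= word_mass p m.
Proof.
rewrite /word_mass [leRHS]big_mkcond; apply: ler_sum => w _; rewrite /F.
have w0 := weight_ge0 p0 w.
by case: eqP => _ /=; case: (typical w) => /=; rewrite ?mulr1 ?mulr0.
Qed.

Lemma typical_mass_ge0 : 0 <= X. Proof. by apply: sumr_ge0 => w _; exact:
  typical_weight_ge0. Qed.

Lemma atypical_mass :
  \sum_(w : word | ((\sum_i w i)%N == m) && ~~ typical w) weight p w <= B.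
Proof.
have d01 : 0 <= delta <= 2 / 3.
  have q1 := lower_prob_le1; have e0 := eta0; have e1 := eta1; have qpos := q0.
  rewrite /delta; apply/andP; split; last by nra.
  by rewrite !mulr_ge0 // ltW.
have hz := @cnt_tail R m p p0 p1 0%N delta (ltn0Sn _) d01.
have hr := @cnt_tail R m p p0 p1 r delta rn d01.
have -> : B = 2 * expR (- (n%:R * delta ^+ 2 / 4)) + 2 * expR (- (n%:R * delta ^+
  2 / 4)).
  by rewrite /B; ring.
apply: le_trans (lerD hz hr).
rewrite big_mkcond [X in _ <= X + _]big_mkcond [X in _ <= _ + X]big_mkcond /=.
rewrite -big_split /=; apply: ler_sum => w _; have w0 := weight_ge0 p0 w.
rewrite /typical negb_and.
case: (_ == m) => /=; case: (`|_ - n%:R * p 0%N| <= _) => /=;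
  case: (`|_ - n%:R * p r| <= _) => /=;
  by rewrite ?addr0 ?add0r ?lerDl ?addr_ge0.
Qed.

Lemma occ_count_gt0 (w : word) :
  [exists i, occ u w i] = (0 < occ_count u w)%N.
Proof.
rewrite /occ_count lt0n sum_nat_eq0 negb_forall; apply: eq_existsb => i.
by case: (occ u w i).
Qed.

(** Markov's inequality on typical words, plus the weight of the others. *)
Lemma hit_mass_upper : hit_mass s <= 2 * (n%:R * pi) * word_mass p m + B.
Proof.
have lo0 : 0 <= 1 - eta by rewrite subr_ge0.
have /andP [_ mean] := occ_mean_bounds typical_weight_exchangeable
  typical_weight_ge0 p0 lo0 pattern_size_le typical_draw.
have pi0 : 0 <= pi by rewrite /pi prodr_ge0.
have X0 := typical_mass_ge0; have XZ := typical_mass_le.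
apply: (@le_trans _ _ (\sum_w F w * (occ_count u w)%:R + B)).
  apply: le_trans (lerD (lexx _) atypical_mass).
  rewrite /hit_mass big_mkcond [X in _ <= _ + X]big_mkcond /= -big_split /=.
  apply: ler_sum => w _; have w0 := weight_ge0 p0 w.
  rewrite occ_count_gt0 /F; case: (_ == m) => /=; last by rewrite !mulr0 mul0r addr0.
  case: (typical w) => /=; last by rewrite mulr0 mul0r add0r; case: ifP.
  by rewrite mulr1 addr0; case: ltnP => N0; rewrite ?mulr_ge0 // ler_peMr // ler1n.
rewrite lerD2r; apply: le_trans mean _.
have h1 : (1 + eta) ^+ k <= 2.
  by apply: le_trans pow_1D_le _; have := slack_le1; lra.
have npi0 : 0 <= n%:R * pi by rewrite mulr_ge0.
rewrite -/pi -/k -/X mulrAC [2 * _]mulrC [leRHS]mulrAC.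
rewrite ler_pM ?mulr_ge0 ?exprn_ge0 //; last by rewrite ler_wpM2l.
by rewrite addr_ge0 // ltW.
Qed.

(** Chebyshev's inequality on typical words, applied around n pi, plus the
    weight of the others. *)
Lemma miss_mass_upper : 0 < pi ->
  word_mass p m - hit_mass s
    <= (2 / (n%:R * pi) + 3 * theta) * word_mass p m + B.
Proof.
move=> pi0.
have lo0 : 0 <= 1 - eta by rewrite subr_ge0.
have /andP [mean1 mean2] := occ_mean_bounds typical_weight_exchangeable
  typical_weight_ge0 p0 lo0 pattern_size_le typical_draw.
have second := occ_second_moment_bound typical_weight_exchangeable
  typical_weight_ge0 p0 lo0 pattern_size_le typical_draw.
rewrite -/u -/k -/pi -/X in mean1 mean2 second.
have X0 := typical_mass_ge0; have XZ := typical_mass_le.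
set M1 := \sum_w F w * (occ_count u w)%:R in mean1 mean2 second.
set M2 := \sum_w _ in second.
set a := n%:R * pi in mean1 mean2 second *.
have a0 : 0 < a by rewrite mulr_gt0.
have t0 := slack_ge0; have t1 := slack_le1.
have var : \sum_w F w * ((occ_count u w)%:R - a) ^+ 2 = M2 - 2 * a * M1 + a ^+ 2 * X.
  rewrite /M2 /M1 /X !mulr_sumr -sumrB -big_split /=.
  by apply: eq_bigr => w _; ring.
have var_le : M2 - 2 * a * M1 + a ^+ 2 * X <= (2 * a + 3 * theta * a ^+ 2) * X.
  have e1 : a * (1 - theta) * X <= M1.
    by apply: le_trans mean1; rewrite ler_wpM2r // ler_wpM2l ?pow_1B_ge // ltW.
  have e2 : M1 <= a * (1 + theta) * X.
    by apply: (le_trans mean2); rewrite ler_wpM2r // ler_wpM2l ?pow_1D_le // ltW.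
  have e3 : M2 <= M1 + a ^+ 2 * (1 + theta) * X.
    apply: (le_trans second); rewrite lerD2l ler_wpM2r // exprMn ler_wpM2l ?sqr_ge0 //.
    exact: pow_1D_sqr_le.
  have e4 : 2 * a * (a * (1 - theta) * X) <= 2 * a * M1.
    by rewrite ler_wpM2l // mulr_ge0 // ltW.
  have e5 : a * (1 + theta) * X <= 2 * a * X.
    by rewrite ler_wpM2r // [2 * a]mulrC ler_wpM2l ?(ltW a0) //; lra.
  have : M2 - 2 * a * M1 + a ^+ 2 * X <= 2 * a * X + a ^+ 2 * (1 + theta) * X
    - 2 * a * (a * (1 - theta) * X) + a ^+ 2 * X by lra.
  by move/le_trans; apply; rewrite le_eqVlt; apply/orP; left; apply/eqP; ring.
have -> : word_mass p m - hit_mass s =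
    \sum_(w : word | ((\sum_i w i)%N == m) && ~~ [exists i, occ u w i]) weight p w.
  rewrite /word_mass (bigID (fun w : word => [exists i, occ u w i])) /=.
  by rewrite /hit_mass addrC addrK.
apply: (@le_trans _ _ (a ^- 2 * \sum_w F w * ((occ_count u w)%:R - a) ^+ 2 + B)).
  apply: le_trans (lerD (lexx _) atypical_mass).
  rewrite mulr_sumr big_mkcond [X in _ <= _ + X]big_mkcond /= -big_split /=.
  apply: ler_sum => w _; have w0 := weight_ge0 p0 w.
  rewrite occ_count_gt0 -leqNgt leqn0 /F.
  case: (_ == m) => /=; last by rewrite !mulr0 mul0r mulr0 addr0.
  case: (typical w) => /=; last by rewrite mulr0 mul0r mulr0 add0r; case: ifP.
  rewrite mulr1 addr0; case: eqP => [->|_].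
    by rewrite sub0r sqrrN mulrCA mulVf ?mulr1 // expf_neq0 // gt_eqF.
  by rewrite mulr_ge0 ?invr_ge0 ?sqr_ge0 // mulr_ge0 ?sqr_ge0.
rewrite lerD2r var.
apply: (@le_trans _ _ (a ^- 2 * ((2 * a + 3 * theta * a ^+ 2) * X))).
  by rewrite ler_wpM2l // invr_ge0 sqr_ge0.
have -> : a ^- 2 * ((2 * a + 3 * theta * a ^+ 2) * X) = (2 / a + 3 * theta) * X.
  by field; rewrite gt_eqF.
rewrite ler_wpM2l // addr_ge0 //; last exact: mulr_ge0.
by rewrite divr_ge0 // ltW.
Qed.

End Hit.

(** * Occurrences of trees of logarithmic size *)

Section Asymptotics.
Context (R : realType).

Lemma eighth_root (n : nat) : exists y : R, 0 <= y /\ n%:R = y ^+ 8.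
Proof.
exists (Num.sqrt (Num.sqrt (Num.sqrt n%:R))); split; first exact: sqrtr_ge0.
by rewrite -[8%N]/(2 * (2 * 2))%N !exprM !sqr_sqrtr ?sqrtr_ge0.
Qed.

Lemma ln_le_sqrt (y : R) : 1 <= y -> ln y <= 2 * Num.sqrt y.
Proof.
move=> y1; have y0 : 0 < y by lra.
have s0 : 0 < Num.sqrt y by rewrite sqrtr_gt0.
have -> : ln y = 2 * ln (Num.sqrt y) by rewrite mulr_natl -lnXn // sqr_sqrtr // ltW.
rewrite ler_pM2l //.
have := @le_ln1Dx _ (Num.sqrt y - 1); rewrite [1 + (_ - 1)]addrC subrK.
by move=> /(_ ltac:(lra)); lra.
Qed.

Variables (p : nat -> R) (v : R) (h r : nat).
Hypothesis cp : critical_law p v.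
Hypothesis r2 : (2 <= r)%N.
Hypothesis pr : 0 < p r.
Hypothesis pz : 0 < p 0%N.
Hypothesis h_dvd : forall i, 0 < p i -> (h %| i)%N.
Hypothesis h_max : forall g, (forall i, 0 < p i -> (g %| i)%N) -> (g <= h)%N.

(** The relative error eta is taken to be n^(-1/8): for a tree of O(log n)
    nodes the accumulated error (tsize s) eta tends to 0, while the Chernoff
    exponent n eta^2 = n^(3/4) still dominates the order n^(1/2) of the exponent
    lost in [word_mass_lower_bound]. *)
Lemma hit_asymptotics (K0 eps : R) : 0 < K0 -> 0 < eps ->
  exists N0, forall m, (N0 <= m)%N -> (h %| m)%N ->
    0 < word_mass p m /\
    forall s (pi := \prod_(c <- preorder s) p c),
      {in preorder s, forall c, c \in [:: 0%N; r]} ->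
      (tsize s)%:R <= K0 * ln m.+1%:R -> 0 < pi ->
      hit_mass m p s / word_mass p m <= 2 * (m.+1%:R * pi) + eps /\
      1 - hit_mass m p s / word_mass p m <= 2 / (m.+1%:R * pi) + eps.
Proof.
move=> K00 eps0.
have v0 : 0 <= v.
  by apply: le_trans (law_factorial2_le cp 0); rewrite big_ord0.
have [C [q1 [q10 q11 Zlow]]] := word_mass_lower_bound cp r2 pr pz h_dvd h_max.
pose q := Num.min (p 0%N) (p r).
have q0 : 0 < q by rewrite lt_min pz.
have qz : q <= p 0%N by rewrite ge_min lexx.
have qr : q <= p r by rewrite ge_min lexx orbT.
pose e' := Num.min (q / 8) (Num.min (1 / 6) (eps / 24)).
have e'0 : 0 < e' by rewrite !lt_min !divr_gt0.
have e'1 : e' <= q / 8 by rewrite ge_min lexx.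
have e'2 : e' <= 1 / 6 by rewrite !ge_min lexx orbT.
have e'3 : e' <= eps / 24 by rewrite !ge_min lexx !orbT.
pose l := - ln q1.
have l0 : 0 <= l by rewrite oppr_ge0 ln_le0.
have [D [D0 DE]] : exists D : R, 0 <= D /\ D ^+ 2 = 4 * (v + 1).
  exists (2 * Num.sqrt (v + 1)); split; first by rewrite mulr_ge0 // sqrtr_ge0.
  by rewrite exprMn sqr_sqrtr ?addr_ge0 //; ring.
(* Lower bounds on y = n^(1/8): Y1 makes (tsize s) eta small, Y2 lets the
   Chernoff exponent win by y, Y3 makes L smaller than n, and Y4 makes the
   remaining factor exp(- y) small. *)
pose Y1 := (16 * K0 / e') ^+ 2.
pose Y2 := 64 * (l * (D + 1 + C%:R) + 1) / q ^+ 2.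
pose Y3 := D + C%:R + 3.
pose Y4 := 16 / eps.
have C0 : 0 <= C%:R :> R by [].
have Y10 : 0 <= Y1 by rewrite sqr_ge0.
have Y20 : 0 <= Y2 by rewrite divr_ge0 ?sqr_ge0 // mulr_ge0 // addr_ge0 //
  mulr_ge0 // !addr_ge0.
have Y30 : 3 <= Y3 by rewrite lerDr addr_ge0.
have Y40 : 0 <= Y4 by rewrite divr_ge0 // ltW.
pose Y := Y1 + Y2 + Y3 + Y4.
exists (maxn r (Num.truncn (Y ^+ 8)).+1) => m; rewrite geq_max => /andP [rm Ym] hm.
have [y [y0 nE]] := eighth_root m.+1.
have Yy : Y <= y.
  rewrite leNgt; apply/negP => yY.
  have : y ^+ 8 < Y ^+ 8 by rewrite ltrXn2r // ltW.
  apply/negP; rewrite -leNgt -nE.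
  apply: le_trans (ltW (truncnS_gt _)) _.
  by rewrite ler_nat; apply: leq_trans Ym _.
have y1 : 3 <= y by rewrite /Y in Yy; lra.
have ypow i j : (i <= j)%N -> y ^+ i <= y ^+ j by move=> ij; apply: ler_weXn2l =>
  //; lra.
pose W := (Num.truncn (D * y ^+ 4)).+1.
have W1 : D * y ^+ 4 <= W%:R by exact: ltW (truncnS_gt _).
have W2 : W%:R <= D * y ^+ 4 + 1.
  by rewrite /W -natr1 lerD2r truncn_le ?mulr_ge0 ?exprn_ge0.
have y41 : 1 <= y ^+ 4 by have := @ypow 0%N 4%N isT; rewrite expr0.
have WC : W%:R + C%:R <= (D + 1 + C%:R) * y ^+ 4.
  have : C%:R <= C%:R * y ^+ 4 by rewrite ler_peMr.
  nra.
have Zlow' : q1 ^+ (W + C) / 2 <= word_mass p m.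
  apply: Zlow => //.
    rewrite nE -[X in X <= _]/(4 * y ^+ (4 * 2) * (v + 1)) exprM.
    have -> : 4 * (y ^+ 4) ^+ 2 * (v + 1) = (D * y ^+ 4) ^+ 2 by rewrite
      [RHS]exprMn DE; ring.
    by rewrite lerXn2r // nnegrE ?ler0n // mulr_ge0 ?exprn_ge0.
  rewrite -(ltr_nat R) natrD.
  have : Y3 * y ^+ 4 <= y ^+ 8.
    rewrite -[8%N]/(4 + 4)%N exprD ler_wpM2r ?exprn_ge0 //.
    by apply: le_trans (@ypow 1%N 4%N isT); rewrite expr1 /Y in Yy *; lra.
  by rewrite -nE -natr1 /Y3; nra.
have Z0 : 0 < word_mass p m by apply: lt_le_trans Zlow'; rewrite divr_gt0 ?exprn_gt0.
split=> // s pi sr sk pi0.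
have seps : (tsize s)%:R <= e' * y.
  apply: (le_trans sk); rewrite nE lnXn; last by lra.
  have yl : ln y <= 2 * Num.sqrt y by apply: ln_le_sqrt; lra.
  have s1 : 16 * K0 / e' <= Num.sqrt y.
    rewrite -[leLHS]ger0_norm ?divr_ge0 ?mulr_ge0 ?(ltW K00) ?(ltW e'0) //
      -sqrtr_sqr ler_wsqrtr //.
    by rewrite -/Y1 /Y in Yy *; lra.
  have sy : Num.sqrt y * Num.sqrt y = y by rewrite -expr2 sqr_sqrtr.
  have s2 : 16 * K0 <= Num.sqrt y * e' by rewrite -ler_pdivrMr.
  have s3 : 16 * K0 * Num.sqrt y <= Num.sqrt y * e' * Num.sqrt y by rewrite
    ler_wpM2r ?sqrtr_ge0.
  have s4 : K0 * ln y <= K0 * (2 * Num.sqrt y) by rewrite ler_wpM2l ?(ltW K00).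
  have -> : e' * y = Num.sqrt y * e' * Num.sqrt y by rewrite mulrAC sy mulrC.
  rewrite -mulr_natl; lra.
pose eta := 1 / y.
have yeta : y * eta = 1 by rewrite /eta; field; lra.
have eta0 : 0 < eta by rewrite divr_gt0; lra.
have eta1 : eta <= 1 by rewrite ler_pdivrMr; lra.
have seta' : (tsize s)%:R * eta <= e'.
  apply: (@le_trans _ _ (e' * y * eta)); first by rewrite ler_wpM2r // ltW.
  by rewrite -mulrA yeta mulr1.
have sn : (2 * tsize s)%:R <= m.+1%:R * eta * q / 4.
  have -> : m.+1%:R * eta * q / 4 = y ^+ 7 * q / 4.
    by rewrite nE exprSr -[y ^+ 7 * y * eta]mulrA yeta mulr1.
  have : y * q <= y ^+ 7 * q.
    by rewrite ler_wpM2r ?(ltW q0) //; apply: (@ypow 1%N 7%N).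
  have : e' * y <= q / 8 * y by rewrite ler_wpM2r.
  rewrite natrM; lra.
have seta : (2 * tsize s)%:R * eta <= 1 / 3 by rewrite natrM; lra.
have hi := hit_mass_upper (law_ge0 cp) (law_mass_le1 cp _) (rm : (r < m.+1)%N)
  q0 qz qr sr eta0 eta1 sn seta.
have lo := miss_mass_upper (law_ge0 cp) (law_mass_le1 cp _) (rm : (r < m.+1)%N)
  q0 qz qr sr eta0 eta1 sn seta pi0.
rewrite -/pi in hi lo.
set B := 4 * expR _ in hi lo.
have BZ : B <= eps / 2 * word_mass p m.
  apply: (@le_trans _ _ (eps / 2 * (q1 ^+ (W + C) / 2))); last by rewrite
    ler_wpM2l // divr_ge0 // ltW.
  have -> : q1 ^+ (W + C) = expR (- (l * (W + C)%:R)).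
    by rewrite -[q1]lnK ?posrE // -expRM_natr; congr expR; rewrite /l; ring.
  have -> : B = 4 * expR (- (q ^+ 2 * y ^+ 6 / 64)).
    rewrite /B; congr (_ * expR (- _)); rewrite nE -[8%N]/(6 + 2)%N exprD.
    have -> : y ^+ 6 * y ^+ 2 * (eta * q / 4) ^+ 2 / 4 = y ^+ 6 * (y * eta) ^+ 2
      * q ^+ 2 / 64 by field.
    by rewrite yeta; ring.
  have E1 : l * (W + C)%:R + y <= q ^+ 2 * y ^+ 6 / 64.
    have a1 : l * (W + C)%:R <= l * ((D + 1 + C%:R) * y ^+ 4) by rewrite natrD
      ler_wpM2l.
    have a2 : y <= y ^+ 4 by apply: (@ypow 1%N 4%N).
    have a3 : 64 * (l * (D + 1 + C%:R) + 1) <= y * q ^+ 2.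
      by rewrite -ler_pdivrMr ?exprn_gt0 // -/Y2 /Y in Yy *; lra.
    have a4 : y * q ^+ 2 * y ^+ 4 <= y ^+ 2 * q ^+ 2 * y ^+ 4.
      by rewrite ler_wpM2r ?exprn_ge0 // ler_wpM2r ?sqr_ge0 //; apply: (@ypow 1%N 2%N).
    have a5 : 64 * (l * (D + 1 + C%:R) + 1) * y ^+ 4 <= y * q ^+ 2 * y ^+ 4 by
      rewrite ler_wpM2r ?exprn_ge0.
    have -> : q ^+ 2 * y ^+ 6 / 64 = (y ^+ 2 * q ^+ 2 * y ^+ 4) / 64 by ring.
    lra.
  have E2 : expR (- (q ^+ 2 * y ^+ 6 / 64)) <= expR (- (l * (W + C)%:R)) * (eps / 16).
    apply: (@le_trans _ _ (expR (- (l * (W + C)%:R)) * expR (- y))).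
      by rewrite -expRD ler_expR; lra.
    rewrite ler_wpM2l ?expR_ge0 // expRN.
    have yexp : y <= expR y by apply: le_trans (expR_ge1Dx y); lra.
    have y4 : 16 <= y * eps by rewrite -ler_pdivrMr // -/Y4 /Y in Yy *; lra.
    rewrite -[leRHS]invrK lef_pV2 ?posrE ?expR_gt0 ?invr_gt0 ?divr_gt0 //.
    apply: le_trans yexp; rewrite invf_div ler_pdivrMr //.
  lra.
have th : 3 * (4 * (tsize s)%:R * eta) <= eps / 2 by lra.
rewrite ler_pdivrMr // [X in _ <= _ /\ X <= _](_ : _ = (word_mass p m - hit_mass
  m p s) / word_mass p m); last first.
  by rewrite mulrBl divff ?gt_eqF.
rewrite ler_pdivrMr //; split.
  by apply: (le_trans hi); rewrite [leRHS]mulrDl lerD2l; nra.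
apply: (le_trans lo); rewrite !mulrDl -addrA lerD2l.
have : 3 * (4 * (tsize s)%:R * eta) * word_mass p m <= eps / 2 * word_mass p m.
  by rewrite ler_wpM2r // ltW.
lra.
Qed.

End Asymptotics.

(** * Complete trees *)

Fixpoint complete_tree (r h : nat) : plane_tree :=
  if h is h'.+1 then Node (nseq r (complete_tree r h')) else Node [::].

Lemma onth_nseq (T : Type) n (x : T) i :
  onth (nseq n x) i = if (i < n)%N then Some x else None.
Proof. by elim: n i => [|n IH] [|i] //=; rewrite IH. Qed.

Lemma complete_tree_is_complete r h : is_complete r h (complete_tree r h).
Proof.
elim: h => [|h IH] [|i v] s //=.
- by move=> [<-].
- by move=> [<-] /=; rewrite size_nseq.
- by rewrite onth_nseq; case: ifP => // _ /IH [h1 h2]; split=> [/h1|[/h2]].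
Qed.

Lemma is_complete_uniq r h t : is_complete r h t -> t = complete_tree r h.
Proof.
elim: h t => [|h IH] [ts] ct.
  by have [_ /(_ erefl) /size0nil /= ->] := ct [::] _ erefl.
have [/(_ isT) /= sz _] := ct [::] _ erefl.
congr Node; suff: ts = nseq (size ts) (complete_tree r h) by rewrite sz.
have {sz} : forall i t, onth ts i = Some t -> t = complete_tree r h.
  move=> i t ti; apply: IH => v s sv.
  have [h1 h2] : ((size (i :: v) < h.+1)%N -> size (children s) = r) /\
    (size (i :: v) = h.+1 -> size (children s) = 0%N).
    by apply: ct; rewrite /= ti.
  by split=> [/h1|e] //; apply: h2; rewrite /= e.
elim: ts {ct} => //= t ts IHts hts; congr cons; first exact: (hts 0%N t erefl).
apply: IHts => i u ui; exact: (hts i.+1).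
Qed.

Lemma fringe_trans t u s :
  fringe_subtrees t u -> fringe_subtrees u s -> fringe_subtrees t s.
Proof.
move=> [v tv] [w uw]; exists (v ++ w).
elim: v t tv => [|i v IH] [ts] /=; first by move=> [->].
by case: (onth ts i) => // t'; exact: IH.
Qed.

Lemma complete_tree_fringe r h k : (0 < r)%N -> (k <= h)%N ->
  fringe_subtrees (complete_tree r h) (complete_tree r k).
Proof.
move=> r0; elim: h => [|h IH]; first by rewrite leqn0 => /eqP ->; exists [::].
rewrite leq_eqVlt => /orP [/eqP ->|kh]; first by exists [::].
apply: fringe_trans (IH kh).
exists [:: 0%N].
rewrite -[LHS]/(obind (fringe_at^~ [::]) (onth (nseq r (complete_tree r h)) 0)).
by rewrite onth_nseq r0.
Qed.

Lemma preorder_complete_treeS r h : preorder (complete_tree r h.+1)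
  = r :: flatten (nseq r (preorder (complete_tree r h))).
Proof. by rewrite /= size_nseq map_nseq. Qed.

Lemma letters_complete_tree r h :
  {in preorder (complete_tree r h), forall c, c \in [:: 0%N; r]}.
Proof.
elim: h => [|h IH] c; first by rewrite !inE => ->.
rewrite preorder_complete_treeS !inE => /orP [->|]; first by rewrite orbT.
case/flattenP => s /nseqP [-> _] /IH; by rewrite !inE.
Qed.

Lemma size_complete_tree r h : (2 <= r)%N ->
  (tsize (complete_tree r h) < 2 * r ^ h)%N.
Proof.
move=> r2; elim: h => // h IH.
rewrite -size_preorder preorder_complete_treeS /= size_flatten /shape map_nseq.
rewrite sumn_nseq size_preorder expnS.
have : (r * (tsize (complete_tree r h)).+1 <= r * (2 * r ^ h))%N by rewrite
  leq_mul2l IH orbT.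
by rewrite mulnS mulnCA mulnC; lia.
Qed.

Section CompleteWeight.
Context (R : realType) (p : nat -> R) (r : nat).
Hypothesis r2 : (2 <= r)%N.
Hypothesis pr : 0 < p r.
Hypothesis pz : 0 < p 0%N.

Let b : R := 1 / (r%:R - 1) * ln (1 / p r).

(** This is r to the power alpha. *)
Definition growth_rate : R := ln (1 / p 0%N) + 1 / (r%:R - 1) * ln (1 / p r).

(** A complete tree has r^h leaves and (r^h - 1) / (r - 1) inner nodes. *)
Lemma complete_tree_weight h :
  \prod_(c <- preorder (complete_tree r h)) p c
    = expR (b - r%:R ^+ h * growth_rate).
Proof.
have r1 : r%:R - 1 != 0 :> R.
  have : 2 <= r%:R :> R by rewrite ler_nat.
  by move=> ?; apply: lt0r_neq0; lra.
have lnV (x : R) : 0 < x -> ln (1 / x) = - ln x by move=> x0; rewrite div1r lnV.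
elim: h => [|h IH].
  rewrite /= big_cons big_nil mulr1 expr0 mul1r /growth_rate -/b.
  by rewrite -{1}[p 0%N]lnK ?posrE //; congr expR; rewrite (lnV (p 0%N)) //; ring.
rewrite preorder_complete_treeS big_cons.
have -> : \prod_(c <- flatten (nseq r (preorder (complete_tree r h)))) p c
  = expR (b - r%:R ^+ h * growth_rate) ^+ r.
  by rewrite big_flatten /= big_nseq iter_mulr_1 IH.
rewrite -{1}[p r]lnK ?posrE // -expRM_natl -expRD; congr expR.
rewrite exprS /b (lnV (p r)) //; field.
by [].
Qed.

End CompleteWeight.

Lemma gcd_set_max (E : set nat) i : E i -> (0 < i)%N ->
  (forall j, E j -> (gcd_set E %| j)%N) /\
  (forall g, (forall j, E j -> (g %| j)%N) -> (g <= gcd_set E)%N).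
Proof.
move=> Ei i0; rewrite /gcd_set /max_nat.
pose D := [set d | forall j, E j -> (d %| j)%N].
have exD : exists d, `[< D d >] by exists 1%N; apply/asboolP.
have ubD d : `[< D d >] -> (d <= i)%N by move=> /asboolP /(_ _ Ei) /dvdn_leq; apply.
have [d /asboolP Dd dmax] := ex_maxnP exD ubD.
have [] := @xgetPex _ 0%N [set m | D m /\ forall k, D k -> (k <= m)%N].
  by exists d; split=> // k Dk; apply/dmax/asboolP.
by move=> h1 h2; split.
Qed.

Lemma max_nat_between (E : set nat) j1 j2 : E j1 -> ~ E j2 ->
  (forall j k, (j <= k)%N -> E k -> E j) -> (j1 <= max_nat E < j2)%N.
Proof.
move=> E1 E2 down; rewrite /max_nat.
have exE : exists d, `[< E d >] by exists j1; apply/asboolP.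
have lt_j2 d : E d -> (d < j2)%N.
  by move=> Ed; rewrite ltnNge; apply/negP => /down /(_ Ed).
have ubE d : `[< E d >] -> (d <= j2)%N by move=> /asboolP /lt_j2 /ltnW.
have [d /asboolP Dd dmax] := ex_maxnP exE ubE.
have [] := @xgetPex _ 0%N [set m | E m /\ forall k, E k -> (k <= m)%N].
  by exists d; split=> // k Dk; apply/dmax/asboolP.
by move=> h1 h2; rewrite h2 // lt_j2.
Qed.

Section GW.
Context (R : realType) (d : measure_display) (Omega : measurableType d)
  (P : probability Omega R).
Variables (xi : {RV P >-> nat}) (xi_ : seq nat -> {RV P >-> nat}) (r : nat).
Hypothesis iid : iid_copies xi xi_.
Hypothesis mean1 : ('E_P[fun w => (xi w)%:R : R] = 1)%E.
Hypothesis var_fin : ('V_P[fun w => (xi w)%:R : R] < +oo)%E.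
Hypothesis r2 : (2 <= r)%N.
Hypothesis pr : 0 < offspring_prob xi r.
Local Notation p := (offspring_prob xi).
Local Notation span := (offspring_span xi).
Local Notation c := (growth_rate p r).

Let p0 := offspring_prob_ge0 xi.
Let pz : 0 < p 0%N := offspring_prob0_gt0 mean1 var_fin r2 pr.

(** All complete trees are possible, and the one of height h contains the
    lower ones. *)
Lemma contains_completeE h : contains_complete xi_ r h
  = [set t | fringe_subtrees t (complete_tree r h)].
Proof.
have poss k : possible xi_ (complete_tree r k).
  rewrite /possible; have [_ ->] := gw_event_tree iid (complete_tree r k).
  by rewrite lte_fin complete_tree_weight // expR_gt0.
apply/seteqP; split => t /= tc.
  apply: tc; split; first exact: poss.
  by exists h => //; exact: complete_tree_is_complete.
move=> s [_ [k kh /is_complete_uniq ->]].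
by apply: fringe_trans tc _; apply: complete_tree_fringe => //; lia.
Qed.

Lemma contains_complete_anti h k : (k <= h)%N ->
  contains_complete xi_ r h `<=` contains_complete xi_ r k.
Proof.
move=> kh t; rewrite !contains_completeE /= => /fringe_trans; apply.
by apply: complete_tree_fringe => //; lia.
Qed.

Lemma word_mass_luk m : word_mass p m
  = m.+1%:R * \sum_(w : {ffun 'I_m.+1 -> 'I_m.+1} | luk (letters w)) weight p w.
Proof.
have := @luk_mass R m p xpredT (fun _ _ => erefl).
rewrite (eq_bigl _ _ (fun w => andbT (_ == m))) -/(word_mass p m) => ->.
by rewrite (eq_bigl _ _ (fun w : {ffun 'I_m.+1 -> 'I_m.+1} => andbT (luk (letters w)))).
Qed.

Lemma cgw_prob_fringe m s :
  cgw_prob xi_ m.+1 [set t | fringe_subtrees t s]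
    = hit_mass m p s / word_mass p m.
Proof.
rewrite (cgw_probE iid) word_mass_luk /hit_mass luk_mass; last first.
  by move=> sh w; exact: exists_occ_shift.
rewrite -mulf_div divff ?pnatr_eq0 // mul1r; congr (_ / _); apply: eq_bigl => w.
have [lw|//] := boolP (luk _); rewrite /=; apply/asboolP/existsP.
  by move=> /(occ_fringe s (esym (preorder_tree_of lw))).
by move=> hw; apply/(occ_fringe s (esym (preorder_tree_of lw))).
Qed.

Lemma cgw_prob_mono m (A B : set plane_tree) : A `<=` B ->
  cgw_prob xi_ m.+1 A <= cgw_prob xi_ m.+1 B.
Proof.
move=> AB; rewrite !(cgw_probE iid) ler_wpM2r //.
  by rewrite invr_ge0 sumr_ge0 // => w _; exact: weight_ge0.
rewrite big_mkcond [leRHS]big_mkcond; apply: ler_sum => w _.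
have w0 := weight_ge0 p0 w; case: (luk _) => //=.
case: asboolP => [/AB h|_]; first by rewrite asboolT.
by case: ifP.
Qed.

Lemma cgw_prob_split m (A B : set plane_tree) :
  cgw_prob xi_ m.+1 A <= cgw_prob xi_ m.+1 (A `\` B) + cgw_prob xi_ m.+1 B.
Proof.
rewrite !(cgw_probE iid) -mulrDl ler_wpM2r //.
  by rewrite invr_ge0 sumr_ge0 // => w _; exact: weight_ge0.
rewrite big_mkcond [X in _ <= X + _]big_mkcond [X in _ <= _ + X]big_mkcond.
rewrite -big_split; apply: ler_sum => w _ /=.
have w0 := weight_ge0 p0 w; case: (luk _) => /=; last by rewrite addr0.
case: asboolP => [Aw|_]; last by rewrite addr_ge0 //; case: ifP.
have [Bw|nBw] := pselect (B (tree_of w)).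
  by rewrite [in X in _ + X]asboolT // lerDr; case: ifP.
by rewrite [in X in X + _]asboolT ?lerDl //; case: ifP.
Qed.

Lemma cgw_probT m : 0 < word_mass p m -> cgw_prob xi_ m.+1 setT = 1.
Proof.
rewrite word_mass_luk => Z0; rewrite (cgw_probE iid).
have e : (fun w : {ffun 'I_m.+1 -> 'I_m.+1} => luk (letters w) && `[< setT
  (tree_of w) >])
  =1 fun w => luk (letters w) by move=> w; rewrite asboolT ?andbT.
rewrite (eq_bigl _ _ e) divff //; apply/eqP => e0.
by rewrite e0 mulr0 ltxx in Z0.
Qed.

Lemma cgw_prob_le1 m A : 0 < word_mass p m -> cgw_prob xi_ m.+1 A <= 1.
Proof. by move=> /cgw_probT <-; exact: cgw_prob_mono. Qed.

Lemma growth_rate_gt0 : 0 < c.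
Proof.
have [v cp] := offspring_critical mean1 var_fin.
have : p 0%N + p r <= 1.
  apply: le_trans (law_mass_le1 cp r.+1).
  rewrite (bigD1 ord0) //= lerD2l (bigD1 ord_max) //=; last first.
    by apply/eqP => /(congr1 val) /=; lia.
  by rewrite lerDl sumr_ge0.
move=> pzr; have pr1 : 0 < ln (1 / p 0%N).
  by rewrite ln_gt0 // ltr_pdivlMr // mul1r; have := pz; have := pr; lra.
rewrite /growth_rate; apply: ltr_wpDr => //; rewrite mulr_ge0 //.
  by rewrite divr_ge0 // subr_ge0 ler1n; lia.
by rewrite ln_ge0 // ler_pdivlMr // mul1r; have := pz; lra.
Qed.

(** Here n pi = exp (ln n + b - r^h c), so the exponents below compare
    r^h c with ln n. *)
Lemma contains_complete_bounds (K0 eps : R) : 0 < K0 -> 0 < eps ->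
  exists N0, forall n, (N0 <= n)%N -> n = 1 %[mod span] ->
    exists m, [/\ n = m.+1, 0 < word_mass p m &
      forall h, r%:R ^+ h <= K0 * ln n%:R ->
      cgw_prob xi_ n (contains_complete xi_ r h)
        <= 2 * expR (ln n%:R + 1 / (r%:R - 1) * ln (1 / p r) - r%:R ^+ h * c) + eps /\
      1 - eps - 2 * expR (r%:R ^+ h * c - ln n%:R - 1 / (r%:R - 1) * ln (1 / p r))
       <= cgw_prob xi_ n (contains_complete xi_ r h)].
Proof.
move=> K00 eps0.
have [v cp] := offspring_critical mean1 var_fin.
have [h_dvd h_max] : (forall j, 0 < p j -> (span %| j)%N) /\
    (forall g, (forall j, 0 < p j -> (g %| j)%N) -> (g <= span)%N).
  have [||h1 h2] := @gcd_set_max [set i | (0 < i)%N /\ 0 < p i] r.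
  - by split; [lia|].
  - by lia.
  split=> [[|j] pj|g gj]; first exact: dvdn0.
    exact: h1.
  by apply: h2 => j [_]; exact: gj.
have K20 : 0 < 2 * K0 by rewrite mulr_gt0.
have [N0 hN] := hit_asymptotics cp r2 pr pz h_dvd h_max K20 eps0.
exists N0.+1 => -[//|m] Nm nmod; exists m.
have hm : (span %| m)%N.
  have /eqP : m.+1 = 1 %[mod span] by [].
  by rewrite eqn_mod_dvd // subn1.
have [Z0 hs] := hN m Nm hm; split=> // h hsize.
have [||] := hs (complete_tree r h) (@letters_complete_tree r h).
- apply: (@le_trans _ _ (2 * r%:R ^+ h)); last by rewrite -mulrA ler_pM2l.
  by rewrite -natrX -natrM ler_nat ltnW // size_complete_tree.
- by rewrite complete_tree_weight // expR_gt0.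
rewrite contains_completeE cgw_prob_fringe complete_tree_weight //.
have -> : m.+1%:R * expR (1 / (r%:R - 1) * ln (1 / p r) - r%:R ^+ h * growth_rate p r)
  = expR (ln m.+1%:R + 1 / (r%:R - 1) * ln (1 / p r) - r%:R ^+ h * c) :> R.
  by rewrite -{1}[m.+1%:R]lnK ?posrE // -expRD addrA.
rewrite -expRN => up lo; split=> //.
have -> : r%:R ^+ h * c - ln m.+1%:R - 1 / (r%:R - 1) * ln (1 / p r)
  = - (ln m.+1%:R + 1 / (r%:R - 1) * ln (1 / p r) - r%:R ^+ h * c) by ring.
lra.
Qed.

End GW.

(** * The two thresholds *)

Lemma ln_nat_large (R : realType) (X : R) :
  exists N0, forall n, (N0 <= n)%N -> X <= ln n%:R.
Proof.
exists (Num.truncn (expR X)).+1 => n Nn.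
have Xn : expR X <= n%:R.
  by apply: le_trans (ltW (truncnS_gt _)) _; rewrite ler_nat.
by rewrite -[X]expRK ler_ln // posrE ?expR_gt0 // (lt_le_trans _ Xn) ?expR_gt0.
Qed.

(** Comparisons with h in terms of logarithms to base r become comparisons
    with r^h; the shift s of the logarithm is a factor r^s on x. *)
Lemma logr_cmp (R : realType) (r : nat) (x c s : R) : (2 <= r)%N -> 0 < x -> 0 < c ->
  forall h : nat,
  (h%:R <= logr r x - logr r c + s) = (r%:R ^+ h * c <= x * expR (s * ln r%:R)) /\
  (logr r x - logr r c + s <= h%:R) = (x * expR (s * ln r%:R) <= r%:R ^+ h * c).
Proof.
move=> r2 x0 c0 h; have r0 : 0 < r%:R :> R by rewrite ltr0n; lia.
have lr : 0 < ln r%:R :> R by rewrite ln_gt0 // ltr1n.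
have -> : r%:R ^+ h * c = expR (h%:R * ln r%:R + ln c).
  by rewrite expRD expRM_natl !lnK.
have -> : x * expR (s * ln r%:R) = expR (ln x + s * ln r%:R).
  by rewrite expRD lnK.
have E : (logr r x - logr r c + s) * ln r%:R = ln x + s * ln r%:R - ln c.
  by rewrite /logr; field; rewrite gt_eqF.
rewrite !ler_expR; split; first by rewrite -lerBrDr -E ler_pM2r.
by rewrite -lerBlDr -E ler_pM2r.
Qed.

Section Thresholds.
Context (R : realType) (d : measure_display) (Omega : measurableType d)
  (P : probability Omega R).
Variables (xi : {RV P >-> nat}) (xi_ : seq nat -> {RV P >-> nat}) (r : nat).
Hypothesis iid : iid_copies xi xi_.
Hypothesis mean1 : ('E_P[fun w => (xi w)%:R : R] = 1)%E.
Hypothesis var_fin : ('V_P[fun w => (xi w)%:R : R] < +oo)%E.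
Hypothesis r2 : (2 <= r)%N.
Hypothesis pr : 0 < offspring_prob xi r.
Local Notation p := (offspring_prob xi).
Local Notation span := (offspring_span xi).
Local Notation c := (growth_rate p r).
Local Notation cgw := (cgw_prob xi_).

Let c0 : 0 < c := growth_rate_gt0 mean1 var_fin r2 pr.
Let b : R := 1 / (r%:R - 1) * ln (1 / p r).

(** For such n, conditioning on |T| = n is meaningful. *)
Definition size_possible (n : nat) : Prop :=
  exists2 m, n = m.+1 & 0 < word_mass p m.

Lemma exp_threshold (eps : R) : 0 < eps ->
  exists A, [/\ 0 < A, 2 * expR (b - A) <= eps / 2 & 2 * expR (- b - A) <= eps / 2].
Proof.
move=> e0; exists (4 / eps + `|b|).
have q0 : 0 < 4 / eps by rewrite divr_gt0.
have key : 2 * expR (- (4 / eps)) <= eps / 2.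
  have : expR (- (4 / eps)) <= eps / 4.
    rewrite expRN -[leRHS]invrK lef_pV2 ?posrE ?expR_gt0 ?invr_gt0 ?divr_gt0 //.
    by rewrite invf_div; apply: le_trans (expR_ge1Dx _); rewrite lerDr.
  lra.
split; first by rewrite ltr_wpDr.
  apply: le_trans key; rewrite ler_pM2l // ler_expR.
  by have := ler_norm b; lra.
apply: le_trans key; rewrite ler_pM2l // ler_expR.
by have := ler_norm (- b); rewrite normrN; lra.
Qed.

Lemma contains_below_threshold (eps : R) : 0 < eps ->
  exists A N0, forall n, (N0 <= n)%N -> n = 1 %[mod span] ->
    size_possible n /\ forall h, r%:R ^+ h * c <= ln n%:R - A ->
      1 - eps <= cgw n (contains_complete xi_ r h).
Proof.
move=> e0; have [A [A0 _ hA]] := exp_threshold e0.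
have e20 : 0 < eps / 2 by rewrite divr_gt0.
have K00 : 0 < c^-1 by rewrite invr_gt0 c0.
have [N0 hN] := contains_complete_bounds iid mean1 var_fin r2 pr K00 e20.
exists A, N0 => n Nn nmod; have [m [nE Z0 hm]] := hN n Nn nmod.
split=> [|h hh]; first by exists m.
have [|_ lo] := hm h.
  by rewrite mulrC ler_pdivlMr //; lra.
apply: le_trans lo; rewrite -/b.
have : expR (r%:R ^+ h * c - ln n%:R - b) <= expR (- b - A) by rewrite ler_expR; lra.
lra.
Qed.

(** The moment bounds need a tree of O(log n) nodes, so they are applied to
    the least height beyond the threshold, whose complete tree is a fringe
    subtree of all higher ones. *)
Lemma contains_above_threshold (eps : R) : 0 < eps ->
  exists A N0, forall n, (N0 <= n)%N -> n = 1 %[mod span] ->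
    size_possible n /\ forall h, ln n%:R + A <= r%:R ^+ h * c ->
      cgw n (contains_complete xi_ r h) <= eps.
Proof.
move=> e0; have [A [A0 hA _]] := exp_threshold e0.
have e20 : 0 < eps / 2 by rewrite divr_gt0.
have r0 : 0 < r%:R :> R by rewrite ltr0n; lia.
have K00 : 0 < 2 * r%:R / c by rewrite divr_gt0 // mulr_gt0.
have [N0 hN] := contains_complete_bounds iid mean1 var_fin r2 pr K00 e20.
have [N1 hN1] := ln_nat_large (A + c).
exists A, (maxn N0 N1) => n; rewrite geq_max => /andP [Nn /hN1 ln_n] nmod.
have [m [nE Z0 hm]] := hN n Nn nmod.
split=> [|h hh]; first by exists m.
have [h' hh' hmin] := @ex_minnP (fun h => ln n%:R + A <= r%:R ^+ h * c) (ex_intro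
  _ h hh).
have h'h : (h' <= h)%N by exact: hmin.
apply: (@le_trans _ _ (cgw n (contains_complete xi_ r h'))).
  rewrite nE; apply: (cgw_prob_mono iid).
  exact: (contains_complete_anti iid mean1 var_fin r2 pr h'h).
have h'0 : (0 < h')%N.
  by rewrite lt0n; apply/eqP => z; move: hh'; rewrite z expr0 mul1r; have := c0; lra.
have h'up : r%:R ^+ h'.-1 * c < ln n%:R + A.
  by rewrite ltNge; apply/negP => /hmin; rewrite leqNgt ltn_predL h'0.
have [|up _] := hm h'.
  rewrite mulrAC ler_pdivlMr // -(prednK h'0) exprS -mulrA -[leRHS]mulrA.
  have : r%:R * (r%:R ^+ h'.-1 * c) <= r%:R * (2 * ln n%:R).
    by rewrite ler_pM2l //; have := c0; lra.
  by rewrite mulrCA.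
apply: (le_trans up); rewrite -/b.
have : expR (ln n%:R + b - r%:R ^+ h' * c) <= expR (b - A) by rewrite ler_expR; lra.
lra.
Qed.

#[local] Instance adm_infty_filter : Filter (adm_infty xi).
Proof. exact: within_filter. Qed.

Lemma near_adm (Q : nat -> Prop) N0 :
  (forall n, (N0 <= n)%N -> n = 1 %[mod span] -> Q n) ->
  \forall n \near adm_infty xi, Q n.
Proof. by move=> h; exists N0 => // n /= Nn nmod; apply: h. Qed.

Lemma cvg_cgw1 (A : nat -> set plane_tree) :
  (forall e, 0 < e -> \forall n \near adm_infty xi,
     size_possible n /\ 1 - e <= cgw n (A n)) ->
  cgw n (A n) @[n --> adm_infty xi] --> (1 : R).
Proof.
move=> h; apply/cvgrPdist_le => e e0.
apply: filterS (h e e0) => n [[m nE Z0] lo].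
rewrite ger0_norm; first by lra.
by rewrite subr_ge0 nE (cgw_prob_le1 iid).
Qed.

Lemma near_ln_ge (X : R) : \forall n \near adm_infty xi, X <= ln n%:R.
Proof.
by have [N0 h] := ln_nat_large X; apply: (@near_adm _ N0) => n Nn _; exact: h.
Qed.

Lemma cgw_contains_whp (omega : nat -> R) (h : nat -> nat) :
  omega n @[n --> adm_infty xi] --> +oo -> h n @[n --> adm_infty xi] --> \oo ->
  (\forall n \near adm_infty xi,
     (h n)%:R <= logr r (ln n%:R - omega n) - logr r c) ->
  cgw n (contains_complete xi_ r (h n)) @[n --> adm_infty xi] --> (1 : R).
Proof.
move=> om hoo hh; apply: cvg_cgw1 => e e0.
have [A [N0 hN]] := contains_below_threshold e0.
have n1 := near_adm hN.
have n2 : \forall n \near adm_infty xi, A <= omega n by move/cvgryPge: om; exact.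
have n3 : \forall n \near adm_infty xi, ((Num.truncn `|logr r c|).+1 <= h n)%N.
  exact: (hoo _ (nbhs_infty_ge _)).
near=> n.
have [sz lo] : size_possible n /\ forall h, r%:R ^+ h * c <= ln n%:R - A ->
      1 - e <= cgw n (contains_complete xi_ r h) by near: n.
split=> //; apply: lo.
have hn : (h n)%:R <= logr r (ln n%:R - omega n) - logr r c by near: n.
have An : A <= omega n by near: n.
have hbig : `|logr r c| < (h n)%:R.
  apply: lt_le_trans (truncnS_gt _) _; rewrite ler_nat; by near: n.
(* Otherwise the logarithm would be 0, against h n > - log_r c. *)
have x0 : 0 < ln n%:R - omega n.
  rewrite ltNge; apply/negP => /ln0 z; move: hn; rewrite {1}/logr z mul0r sub0r.
  by have := ler_norm (- logr r c); rewrite normrN; lra.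
move: hn; have [e1 _] := logr_cmp 0 r2 x0 c0 (h n).
by rewrite -[_ - logr r c]addr0 e1 mul0r expR0 mulr1; lra.
Unshelve. all: by end_near. Qed.

Lemma cgw_contains_not_whp (omega : nat -> R) (h : nat -> nat) :
  omega n @[n --> adm_infty xi] --> +oo ->
  (\forall n \near adm_infty xi,
     (h n)%:R >= logr r (ln n%:R + omega n) - logr r c) ->
  cgw n (~` contains_complete xi_ r (h n)) @[n --> adm_infty xi] --> (1 : R).
Proof.
move=> om hh; apply: cvg_cgw1 => e e0.
have [A [N0 hN]] := contains_above_threshold e0.
have n1 := near_adm hN.
have n2 : \forall n \near adm_infty xi, Num.max A 1 <= omega n by move/cvgryPge:
  om; exact.
have n3 := near_ln_ge 0.
near=> n.
have [sz up] : size_possible n /\ forall h, ln n%:R + A <= r%:R ^+ h * c ->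
      cgw n (contains_complete xi_ r h) <= e by near: n.
split=> //.
have hn : (h n)%:R >= logr r (ln n%:R + omega n) - logr r c by near: n.
have : Num.max A 1 <= omega n by near: n.
rewrite ge_max => /andP [An o1].
have ln0 : 0 <= ln n%:R :> R by near: n.
have x0 : 0 < ln n%:R + omega n by lra.
have /up {}up : ln n%:R + A <= r%:R ^+ h n * c.
  apply: (@le_trans _ _ (ln n%:R + omega n)); first by rewrite lerD2l.
  move: hn; have [_ e1] := logr_cmp 0 r2 x0 c0 (h n).
  by rewrite -[_ - logr r c]addr0 e1 mul0r expR0 mulr1.
have [m nE Z0] := sz.
have := cgw_prob_split iid m setT (contains_complete xi_ r (h n)).
by rewrite setTD (cgw_probT iid) // -nE; lra.
Unshelve. all: by end_near. Qed.

(** The largest height is at least the last h below the first threshold and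
    less than the first h above the second one; shifting the base-r logarithm by
    eps changes ln n by a constant factor, hence by more than any constant. *)
Lemma max_complete_concentrated (eps : R) : 0 < eps ->
  cgw n [set t | Num.floor (logr r (ln n%:R) - logr r c - eps)
                   <= (max_complete xi_ r t)%:Z
                   <= Num.floor (logr r (ln n%:R) - logr r c + eps)]
    @[n --> adm_infty xi] --> (1 : R).
Proof.
move=> eps0; apply: cvg_cgw1 => e e0.
have e20 : 0 < e / 2 by rewrite divr_gt0.
have [A1 [N1 hN1]] := contains_below_threshold e20.
have [A2 [N2 hN2]] := contains_above_threshold e20.
have lr : 0 < ln r%:R :> R by rewrite ln_gt0 // ltr1n.
pose lo : R := expR (- eps * ln r%:R).
pose hi : R := expR (eps * ln r%:R).
have lo0 : 0 < lo by exact: expR_gt0.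
have lo1 : lo < 1 by rewrite expR_lt1 mulNr oppr_lt0 mulr_gt0.
have hi1 : 1 < hi by rewrite expR_gt1 mulr_gt0.
have n3 := near_ln_ge 1.
have n4 := near_ln_ge (A1 / (1 - lo)).
have n5 := near_ln_ge (A2 / (hi - 1)).
have n6 := near_ln_ge (c / lo).
near=> n.
have [[m nE Z0] below] : size_possible n /\ forall h, r%:R ^+ h * c <= ln n%:R - A1 ->
      1 - e / 2 <= cgw n (contains_complete xi_ r h).
  by near: n; exact: near_adm hN1.
have [_ above] : size_possible n /\ forall h, ln n%:R + A2 <= r%:R ^+ h * c ->
      cgw n (contains_complete xi_ r h) <= e / 2.
  by near: n; exact: near_adm hN2.
have x1 : 1 <= ln n%:R :> R by near: n.
have xA1 : A1 <= ln n%:R * (1 - lo) by rewrite -ler_pdivrMr ?subr_gt0 //; near: n.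
have xA2 : A2 <= ln n%:R * (hi - 1) by rewrite -ler_pdivrMr ?subr_gt0 //; near: n.
have xc : c <= ln n%:R * lo by rewrite -ler_pdivrMr //; near: n.
split; first by exists m.
have x0 : 0 < ln n%:R :> R by lra.
set f1 := Num.floor _; set f2 := Num.floor _.
have f10 : 0 <= f1.
  rewrite /f1 floor_ge0; have [e1 _] := logr_cmp (- eps) r2 x0 c0 0%N.
  by move: xc; rewrite -[X in X <= _]mul1r -(expr0 r%:R) -e1.
have f12 : f1 <= f2 by apply: le_floor; lra.
have [j1 j1E] : exists j1 : nat, f1 = j1%:Z by exists `|f1|%N; rewrite gez0_abs.
have [j2 j2E] : exists j2 : nat, f2 + 1 = j2%:Z.
  by exists (absz (f2 + 1)); rewrite gez0_abs // addr_ge0 // (le_trans f10).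
have b1 : 1 - e / 2 <= cgw n (contains_complete xi_ r j1).
  apply: below; have [e1 _] := logr_cmp (- eps) r2 x0 c0 j1.
  have : r%:R ^+ j1 * c <= ln n%:R * lo by rewrite -e1 -[j1%:R]/(j1%:Z%:~R) -j1E
    Num.Theory.floor_le.
  lra.
have b2 : cgw n (contains_complete xi_ r j2) <= e / 2.
  apply: above; have [_ e1] := logr_cmp eps r2 x0 c0 j2.
  have : ln n%:R * hi <= r%:R ^+ j2 * c.
    by rewrite -e1 -[j2%:R]/(j2%:Z%:~R) -j2E ltW // floorD1_gt.
  lra.
have := cgw_prob_split iid m (contains_complete xi_ r j1) (contains_complete xi_ r j2).
rewrite -nE => sp.
apply: (@le_trans _ _ (cgw n (contains_complete xi_ r j1 `\` contains_complete
  xi_ r j2))).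
  lra.
rewrite nE; apply: (cgw_prob_mono iid) => t [t1 t2].
have /andP [m1 m2] := @max_nat_between [set h | contains_complete xi_ r h t] j1 j2 t1 t2
  (fun j k jk => contains_complete_anti iid mean1 var_fin r2 pr jk (t:=t)).
apply/andP; split; first by rewrite j1E lez_nat.
by rewrite -ltzD1 j2E ltz_nat.
Unshelve. all: by end_near. Qed.

End Thresholds.

Theorem lemma13 (R : realType) (d : measure_display) (Omega : measurableType d)
    (P : probability Omega R) (xi : {RV P >-> nat})
    (xi_ : seq nat -> {RV P >-> nat}) (r : nat)
    (iid : iid_copies xi xi_)
    (mean1 : ('E_P[fun w => (xi w)%:R : R] = 1)%E)
    (var_gt0 : (0 < 'V_P[fun w => (xi w)%:R : R])%E)
    (var_fin : ('V_P[fun w => (xi w)%:R : R] < +oo)%E)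
    (r_ge2 : (2 <= r)%N)
    (pr_gt0 : 0 < offspring_prob xi r) :
  let a : R := alpha r (offspring_prob xi) in
  (* The hypotheses on h n are only required for large n; there the arguments
     of the outer logarithms are positive, because h n tends to infinity in the
     first case (and ln is 0 on nonpositive reals) and omega n does in the
     second. *)
  (forall (omega : nat -> R) (h : nat -> nat),
     omega n @[n --> adm_infty xi] --> +oo ->
     h n @[n --> adm_infty xi] --> \oo ->
     (forall n, (0 < h n)%N) ->
     ((\forall n \near adm_infty xi,
         (h n)%:R <= logr r (ln n%:R - omega n) - a) ->
      cgw_prob xi_ n (contains_complete xi_ r (h n))
        @[n --> adm_infty xi] --> (1 : R)) /\
     ((\forall n \near adm_infty xi,
         (h n)%:R >= logr r (ln n%:R + omega n) - a) ->
      cgw_prob xi_ n (~` contains_complete xi_ r (h n))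
        @[n --> adm_infty xi] --> (1 : R))) /\
  (* H_{n,r} is an integer, so H_{n,r} - log_r log n tends to -a up to rounding:
     H_{n,r} is the integer part of log_r log n - a + o(1), with the o(1) in
     probability. *)
  (forall eps : R, 0 < eps ->
     cgw_prob xi_ n
       [set t | Num.floor (logr r (ln n%:R) - a - eps)
                  <= (max_complete xi_ r t)%:Z
                  <= Num.floor (logr r (ln n%:R) - a + eps)]
       @[n --> adm_infty xi] --> (1 : R)).
Proof.
split=> [omega h om hoo _|eps eps0].
  split=> hh; first exact: cgw_contains_whp om hoo hh.
  exact: cgw_contains_not_whp om hh.
exact: max_complete_concentrated.
Qed.
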